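(* For every finitely generated associative unital ring $R$ and every $\beta\in(0,1-\alpha_0)$ we have \[ \omega\bigl(\mathrm{EL}_{2^{n+2}}(R)\bigr)\le\exp\bigl(2^{-\beta(n+2)}\bigr) \] for all sufficiently large $n$. In particular, the infimal exponential growth rates $\omega(\mathrm{EL}_{2^{n+2}}(R))$ tend to $1$ as $n\to\infty$.
   Context: For a ring $R$, $\mathrm{EL}_m(R)\le\mathrm{GL}_m(R)$ is the subgroup generated by all elementary matrices $I+rE_{i,j}$ with $i\ne j$, $r\in R$. (It is finitely generated when $m\ge 3$ and $R$ is finitely generated.) Rings are not assumed commutative. The constant $\alpha_0=\log(2)/\log(2/\eta)\approx 0.7674$, where $\eta$ is the unique real root of $x^3+x^2+x-2$. For a group $G$ with finite generating set $S$, $\gamma_G^S(\ell)$ is the number of elements of $G$ that can be represented by words of length at most $\ell$ over $S\cup S^{-1}$; $\omega(G,S)=\lim_{\ell\to\infty}\sqrt[\ell]{\gamma_G^S(\ell)}$; and the infimal exponential growth rate is $\omega(G)=\inf_S\omega(G,S)$, the infimum over all finite generating sets $S$ of $G$. *)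

(* Defs.v *)
From HB Require Import structures.
From mathcomp Require Import all_boot all_order all_algebra finmap.
From mathcomp Require Import all_classical all_reals all_analysis.
From mathcomp Require Import ring lra.
Import Order.TTheory GRing.Theory Num.Theory.
Import numFieldNormedType.Exports.

Set Implicit Arguments.
Unset Strict Implicit.
Unset Printing Implicit Defensive.

Local Open Scope classical_set_scope.
Local Open Scope ring_scope.

Definition fg_ring (A : pzRingType) : Prop :=
  exists s : seq A,
    smallest (fun B : set A => GRing.subring_closed [in B]) [set` s] = setT.

Definition generated (G : groupType) (X : set G) : set G :=
  smallest (fun H : set G => group_closed [in H]) X.

Lemma generated_group_closed (G : groupType) (X : set G) :
  group_closed [in generated X].
Proof.
split=> [|x y]; rewrite !inE.
  by move=> H /= [[H1 _] _]; move: H1; rewrite inE.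
move=> gx gy H /= CH; case: (CH) => -[_ HV] _.
by have := HV x y; rewrite !inE; apply; [exact: gx | exact: gy].
Qed.

Record subgroup_gen (G : groupType) (X : set G) := SubgroupGen {
  subgroup_gen_val :> G;
  subgroup_gen_valP : subgroup_gen_val \in generated X }.

Section SubgroupGenGroup.
Variables (G : groupType) (X : set G).
HB.instance Definition _ := [isSub for @subgroup_gen_val G X].
HB.instance Definition _ := [Choice of subgroup_gen X by <:].
HB.instance Definition _ := SubChoice_isSubGroup.Build G [in generated X]
  (subgroup_gen X) (@generated_group_closed G X).
End SubgroupGenGroup.

Section Growth.
Variable G : groupType.
Implicit Types (S : {fset G}) (l : nat).

Definition word_ball S l : set G :=
  [set g | exists w : seq G,
    [/\ (size w <= l)%N,
        all (fun a => (a \in S) || (a^-1 \in S)%g) w &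
        g = (\prod_(a <- w) a)%g]].

Lemma finite_word_ball S l : finite_set (word_ball S l).
Proof.
have finS : finite_set ([set` S] `|` [set a^-1%g | a in [set` S]]).
  by rewrite finite_setU; split; [|apply: finite_image]; exact: finite_fset.
elim: l => [|l IH].
  apply: (@sub_finite_set _ _ [set 1%g]); last exact: finite_set1.
  by move=> g [[|a w] [//= _ _ ->]]; rewrite big_nil.
apply: (@sub_finite_set _ _ ([set 1%g] `|`
  [set (p.1 * p.2)%g | p in
    ([set` S] `|` [set a^-1%g | a in [set` S]]) `*` word_ball S l])); last first.
  rewrite finite_setU; split; first exact: finite_set1.
  by apply: finite_image; exact: finite_setX.
move=> g [[|a w] [/= sw aw ->]]; first by left; rewrite big_nil.
right; case/andP: aw => aS wS; exists (a, (\prod_(b <- w) b)%g); last first.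
  by rewrite big_cons.
split=> /=; last by exists w; split.
by case/orP: aS => aS; [left | right; exists a^-1%g; rewrite ?invgK].
Qed.

(* [fset_set] is meaningful here by [finite_word_ball]. *)
Definition growth S l : nat := #|` fset_set (word_ball S l)|.

Definition growth_rate (R : realType) S : R :=
  limn (fun l : nat => (growth S l)%:R `^ (l%:R^-1)).

(* Extended-real valued: the infimum is +oo when G is not finitely generated. *)
Definition inf_growth_rate (R : realType) : \bar R :=
  ereal_inf [set (growth_rate R S)%:E | S in
             [set S : {fset G} | generated [set` S] = setT]].

End Growth.

Definition is_inverse (B : pzRingType) (x y : B) : Prop :=
  x * y = 1 /\ y * x = 1.

Definition invertible (B : pzRingType) : set B :=
  [set x | exists y, is_inverse x y].

(* The library's [unitmx] and {'GL_n[R]} need commutative coefficients. *)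
Record GL (A : pzRingType) (m : nat) := MkGL {
  GL_val :> 'M[A]_m;
  GL_valP : GL_val \in @invertible 'M[A]_m }.

Section GLGroup.
Variables (A : pzRingType) (m : nat).
HB.instance Definition _ := [isSub for @GL_val A m].
HB.instance Definition _ := [Choice of GL A m by <:].
Implicit Types x y z : GL A m.

Lemma GL_one_subproof : (1 : 'M[A]_m) \in @invertible 'M[A]_m.
Proof. by rewrite inE; exists 1; split; rewrite mulr1. Qed.

Lemma GL_mul_subproof x y : GL_val x * GL_val y \in @invertible 'M[A]_m.
Proof.
have := GL_valP x; rewrite inE => -[x' [xx' x'x]].
have := GL_valP y; rewrite inE => -[y' [yy' y'y]].
rewrite inE; exists (y' * x'); split.
  by rewrite mulrA -(mulrA (GL_val x)) yy' mulr1.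
by rewrite mulrA -(mulrA y') x'x mulr1.
Qed.

Definition GL_invmx x : 'M[A]_m := xget 1 (is_inverse (GL_val x)).

Lemma GL_invmxP x : is_inverse (GL_val x) (GL_invmx x).
Proof.
have := GL_valP x; rewrite inE => -[x' x'P].
by rewrite /GL_invmx; case: xgetP => // /(_ _ x'P).
Qed.

Lemma GL_inv_subproof x : GL_invmx x \in @invertible 'M[A]_m.
Proof. by rewrite inE; exists (GL_val x); have [? ?] := GL_invmxP x. Qed.

Definition GL_one := MkGL GL_one_subproof.
Definition GL_mul x y := MkGL (GL_mul_subproof x y).
Definition GL_inv x := MkGL (GL_inv_subproof x).

Lemma GL_mulA : associative GL_mul.
Proof. by move=> x y z; apply/val_inj; rewrite /= mulrA. Qed.
Lemma GL_mul1x : left_id GL_one GL_mul.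
Proof. by move=> x; apply/val_inj; rewrite /= mul1r. Qed.
Lemma GL_mulx1 : right_id GL_one GL_mul.
Proof. by move=> x; apply/val_inj; rewrite /= mulr1. Qed.
Lemma GL_mulVx : left_inverse GL_one GL_inv GL_mul.
Proof. by move=> x; apply/val_inj; have [] := GL_invmxP x. Qed.
Lemma GL_mulxV : right_inverse GL_one GL_inv GL_mul.
Proof. by move=> x; apply/val_inj; have [] := GL_invmxP x. Qed.

HB.instance Definition _ :=
  isGroup.Build (GL A m) GL_mulA GL_mul1x GL_mulx1 GL_mulVx GL_mulxV.

Definition elementary : set (GL A m) :=
  [set x | exists (i j : 'I_m) (r : A),
    i != j /\ GL_val x = 1%:M + r *: delta_mx i j].

Definition EL := subgroup_gen elementary.
HB.instance Definition _ := Group.on EL.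

End GLGroup.

Section Constants.
Variable R : realType.

Definition eta_poly : {poly R} := 'X^3 + 'X^2 + 'X - 2%:P.

Lemma eta_poly_root_unique : exists! x : R, root eta_poly x.
Proof.
have hE (x : R) : eta_poly.[x] = x ^+ 3 + x ^+ 2 + x - 2.
  by rewrite /eta_poly !hornerE.
have [|x _ rx] := @poly_ivt R eta_poly 0 1 ler01.
  by rewrite !hE; apply/andP; split; lra.
exists x; split=> // y ry; move: rx ry; rewrite !rootE !hE => /eqP rx /eqP ry.
apply/eqP; rewrite -subr_eq0; apply/negPn/negP => xy.
have : (x - y) * (x ^+ 2 + x * y + y ^+ 2 + x + y + 1) = 0.
  by transitivity ((x ^+ 3 + x ^+ 2 + x - 2) - (y ^+ 3 + y ^+ 2 + y - 2));
    [ring | rewrite rx ry subr0].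
move/eqP; rewrite mulf_eq0 (negbTE xy) /= => /eqP q0.
have := sqr_ge0 (x + y); have := sqr_ge0 (x + 1); have := sqr_ge0 (y + 1).
nra.
Qed.

Definition eta : R := xget 0 [set x | root eta_poly x].

Definition alpha0 : R := ln 2 / ln (2 / eta).

End Constants.

(* Main.v *)
Require Import Defs.
From mathcomp Require Import all_boot all_order all_algebra perm finmap.
From mathcomp Require Import all_classical all_reals all_analysis.
From mathcomp Require Import ring lra zify.
Import Order.TTheory GRing.Theory Num.Theory.
Import numFieldNormedType.Exports.

(* Let Grigorchuk's group <a, b, c, d> act on the n-th level {0,1}^n of the
   binary tree; its Schreier graph is a path of length 2^n - 1 with ends 1^n and
   1^(n-1)0. Take four copies of this path, 2^(n+2) points in all, and generate
   EL_{2^(n+2)}(A) by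
   - the permutation matrices of a, b, c, d, acting on all copies at once;
   - elementary matrices joining two copies at the end 1^n, with entries in a
     symmetric finite set of ring generators;
   - the even permutations of the eight points of all copies that are at the
     end 1^(n-1)0 or its neighbour.
   The last ones break the block structures preserved by the tree action, so all
   elementary matrices are obtained by conjugation and commutators. On the other
   hand, in a word of length l < 2^(n-1) the two kinds of local generators act
   far apart. Moving the tree letters to the right writes such a word as a
   commuting product of elementary matrices, times a permutation, times an
   element of the tree group, where the first two factors are supported on the
   images of the two ends under prefixes of the word.
   With Bartholdi's weights a word of weight (2/eta)^k has 2^k sections at
   level k of total weight O(2^k). This bounds both the number of
   elements of the tree group and the number of prefix images of an end, so that
   the ball of radius l ~ 2^n contains at most exp(O(n 2^k)) elements, where
   2^k ~ 2^(alpha0 n). Since the growth rate is at most the l-th root of the size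
   of that ball, it is at most exp(O(n 2^((alpha0 - 1) n))). *)

Set Implicit Arguments.
Unset Strict Implicit.
Unset Printing Implicit Defensive.

Local Open Scope classical_set_scope.
Local Open Scope ring_scope.

(** * Growth rates *)

Section Fekete.
Variable R : realType.
Variable u : nat -> R.
Hypothesis u_ge0 : forall n, 0 <= u n.
Hypothesis u_add : forall m n, u (m + n)%N <= u m + u n.

Lemma subadditive_mulnD q m r : u (q * m + r)%N <= q%:R * u m + u r.
Proof.
elim: q => [|q IH]; first by rewrite mul0n add0n mul0r add0r.
rewrite mulSn -addnA; apply: le_trans (u_add _ _) _.
by rewrite -natr1 mulrDl mul1r (addrC _ (u m)) -addrA lerD2l.
Qed.

(** Divide [n] by [m]: the quotient contributes at most [u m / m], and the remainder a bounded
    amount that vanishes after division by [n]. *)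
Lemma subadditive_near (m : nat) (e : R) : (0 < m)%N -> 0 < e ->
  \forall n \near \oo, u n / n%:R <= u m / m%:R + e.
Proof.
move=> m0 e0; pose B := \sum_(r < m) u r.
near=> n.
have n0 : (0 < n)%N by near: n; exists 1%N.
have rB : u (n %% m)%N <= B.
  have lt : (n %% m < m)%N by rewrite ltn_mod.
  rewrite /B (bigD1 (Ordinal lt)) //= lerDl; exact: sumr_ge0.
have := subadditive_mulnD (n %/ m) m (n %% m); rewrite -divn_eq => un.
have nR : 0 < n%:R :> R by rewrite ltr0n.
have mR : 0 < m%:R :> R by rewrite ltr0n.
rewrite ler_pdivrMr //; apply: le_trans un _.
rewrite mulrDl; apply: lerD.
  rewrite (mulrC _ (u m)) -mulrA; apply: ler_wpM2l => //.
  by rewrite mulrC ler_pdivlMr // -natrM ler_nat leq_divM.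
apply: le_trans rB _; rewrite -ler_pdivrMl // mulrC.
near: n; exact: nbhs_infty_ger.
Unshelve. all: by end_near. Qed.

(** The limit is the infimum of all [u m / m], which gives the second clause. *)
Lemma fekete : exists2 v : R, u n / n%:R @[n --> \oo] --> v &
  forall m, (0 < m)%N -> v <= u m / m%:R.
Proof.
pose X := [set u m / m%:R | m in [set m | (0 < m)%N]].
have lbX : has_lbound X.
  by exists 0 => _ [m _ <-]; apply: divr_ge0.
have infX : has_inf X by split=> //; exists (u 1%N / 1%:R); exists 1%N.
exists (inf X); last by move=> m m0; apply: ge_inf => //; exists m.
apply/cvgrPdist_le => e e0.
have [_ [m m0 <-] mlt] := @inf_adherent _ X (e / 2) (divr_gt0 e0 (ltr0Sn _ _)) infX.
near=> n.
have n0 : (0 < n)%N by near: n; exists 1%N.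
have h1 : inf X <= u n / n%:R by apply: ge_inf => //; exists n.
have h2 : u n / n%:R <= u m / m%:R + e / 2.
  by near: n; apply: subadditive_near => //; apply: divr_gt0.
rewrite ler0_norm ?subr_le0 //; lra.
Unshelve. all: by end_near. Qed.

End Fekete.

Section GrowthRate.
Variables (R : realType) (G : groupType).
Implicit Types S : {fset G}.

Lemma word_ball1 S l : word_ball S l 1%g.
Proof. by exists [::]; rewrite big_nil. Qed.

Lemma growth_gt0 S l : (0 < growth S l)%N.
Proof.
rewrite /growth cardfs_gt0; apply/fset0Pn; exists 1%g.
by rewrite in_fset_set ?inE; [exact: word_ball1 | exact: finite_word_ball].
Qed.

Lemma growthD S l1 l2 : (growth S (l1 + l2) <= growth S l1 * growth S l2)%N.
Proof.
rewrite /growth.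
set B1 := fset_set (word_ball S l1); set B2 := fset_set (word_ball S l2).
rewrite -(size_allpairs (fun x y => x * y)%g); apply: (uniq_leq_size (fset_uniq _)) => g.
move: (finite_word_ball S l1) (finite_word_ball S l2) => f1 f2.
rewrite in_fset_set ?inE; last exact: finite_word_ball.
case=> w [sw aw ->]; apply/allpairsP.
move: aw; rewrite -{1 2}(cat_take_drop l1 w) all_cat big_cat => /andP[a1 a2].
exists ((\prod_(a <- take l1 w) a)%g, (\prod_(a <- drop l1 w) a)%g).
split=> //=; rewrite in_fset_set // inE.
  by exists (take l1 w); split=> //; rewrite size_take_min geq_minl.
by exists (drop l1 w); split=> //; rewrite size_drop leq_subLR.
Qed.

Lemma growth_rateP S : exists2 v : R, growth_rate R S = expR v &
  0 <= v /\ forall l, (0 < l)%N -> v <= ln (growth S l)%:R / l%:R.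
Proof.
have g0 l : 0 < (growth S l)%:R :> R by rewrite ltr0n growth_gt0.
have [||v vlim vle] := @fekete R (fun l => ln (growth S l)%:R).
- by move=> n; apply: ln_ge0; rewrite ler1n growth_gt0.
- move=> m n; rewrite -lnM ?posrE // ler_ln ?posrE ?mulr_gt0 //.
  by rewrite -natrM ler_nat growthD.
exists v; last first.
  split=> //; rewrite -(cvg_lim (@Rhausdorff R) vlim).
  apply: limr_ge; first by apply: cvgP vlim.
  by apply: nearW => n; apply: divr_ge0 => //; apply: ln_ge0; rewrite ler1n growth_gt0.
rewrite /growth_rate; apply: cvg_lim => //.
under eq_cvg do rewrite /powR gt_eqF // mulrC.
by apply: continuous_cvg => //; exact: continuous_expR.
Qed.

Lemma inf_growth_rate_ge1 : (1 <= inf_growth_rate G R)%E.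
Proof.
apply: le_ereal_inf_tmp => _ [S _ <-]; rewrite lee_fin.
by have [v -> [v0 _]] := growth_rateP S; rewrite -expR0 ler_expR.
Qed.

(** This reduces the theorem to counting one ball, of a well-chosen radius, for one generating
    set. *)
Lemma inf_growth_rate_le S l : generated [set` S] = setT -> (0 < l)%N ->
  (inf_growth_rate G R <= (expR (ln (growth S l)%:R / l%:R))%:E)%E.
Proof.
move=> gS l0; apply: (@le_trans _ _ (growth_rate R S)%:E).
  by apply: ereal_inf_lbound; exists S.
by have [v -> [_ vle]] := growth_rateP S; rewrite lee_fin ler_expR vle.
Qed.

End GrowthRate.

(** * Sections of words in Grigorchuk's group *)

Definition klein : Type := (bool * bool)%type.
Definition kmul (x y : klein) : klein := (x.1 (+) y.1, x.2 (+) y.2).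
Definition kone : klein := (false, false).
Definition kphi (x : klein) : klein := (x.2, x.1 (+) x.2).

(* On the 1-subtree the Klein letter [x] acts as [kphi x], on the 0-subtree as
   [a] if [x.1] and trivially otherwise. So [(true, true)], [(true, false)] and
   [(false, true)] are Grigorchuk's b = (a, c), c = (a, d) and d = (1, b). *)
Definition aflip (s : seq bool) : seq bool :=
  if s is i :: s' then ~~ i :: s' else [::].

Definition aflip_if (e : bool) s := if e then aflip s else s.

Fixpoint kact (x : klein) (s : seq bool) : seq bool :=
  if s is i :: s' then
    if i then true :: kact (kphi x) s' else false :: aflip_if x.1 s'
  else [::].

Lemma aflipK : involutive aflip.
Proof. by case=> //= i s; rewrite negbK. Qed.

Lemma kmul1k x : kmul kone x = x. Proof. by case: x => [[] []]. Qed.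
Lemma kmulk1 x : kmul x kone = x. Proof. by case: x => [[] []]. Qed.
Lemma kphiM x y : kphi (kmul x y) = kmul (kphi x) (kphi y).
Proof. by case: x => [[] []]; case: y => [[] []]. Qed.

Lemma kactM x y s : kact (kmul x y) s = kact x (kact y s).
Proof.
elim: s x y => // -[] s IH x y /=; first by rewrite kphiM IH.
by case: x => [[] ?]; case: y => [[] ?]; rewrite //= /aflip_if /= aflipK.
Qed.

Lemma kact1 s : kact kone s = s.
Proof. by elim: s => //= -[] s IH //=; rewrite IH. Qed.

Lemma kactK x : involutive (kact x).
Proof. by move=> s; rewrite -kactM; case: x => [[] []]; exact: kact1. Qed.

Lemma size_aflip s : size (aflip s) = size s. Proof. by case: s. Qed.

Lemma size_kact x s : size (kact x s) = size s.
Proof.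
elim: s x => // -[] s IH x /=; first by rewrite IH.
by rewrite /aflip_if; case: x.1; rewrite ?size_aflip.
Qed.

(* [(x, [:: y1; ...; ym])] stands for the word [x a y1 a ... a ym]. *)
Definition nform : Type := (klein * seq klein)%type.

Fixpoint nact_rec (x : klein) (w : seq klein) (s : seq bool) : seq bool :=
  kact x (if w is y :: w' then aflip (nact_rec y w' s) else s).
Definition nact (g : nform) := nact_rec g.1 g.2.

Definition kcons (x : klein) (g : nform) : nform := (kmul x g.1, g.2).
Definition acons (g : nform) : nform := (kone, g.1 :: g.2).

Lemma nact_kcons x g s : nact (kcons x g) s = kact x (nact g s).
Proof. by case: g => y [|z w]; rewrite /nact /= kactM. Qed.

Lemma nact_acons g s : nact (acons g) s = aflip (nact g s).
Proof. by case: g => y w /=; rewrite /nact /= kact1. Qed.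

(* The section of [x a y1 a ... a ym] at the output letter [j]. *)
Fixpoint nsec_rec (j : bool) (x : klein) (w : seq klein) : nform :=
  let r := if w is y :: w' then nsec_rec (~~ j) y w' else (kone, [::]) in
  if j then kcons (kphi x) r else if x.1 then acons r else r.
Definition nsec (j : bool) (g : nform) := nsec_rec j g.1 g.2.

(** The wreath recursion. Klein letters keep the first letter and each [a] flips it, so the output
    letter depends on the parity of the number of [a]s. Sections are indexed by the output letter
    because a word is read from its left end, which acts last. *)
Lemma nact_cons g i s :
  nact g (i :: s) =
    let j := i (+) odd (size g.2) in j :: nact (nsec j g) s.
Proof.
case: g => x w; rewrite /nact /nsec /=.
elim: w x => [|y w IH] x /=.
  rewrite addbF; case: i => /=; first by rewrite kmulk1.
  by case: x => [[] x2] //=; rewrite !kact1.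
rewrite IH /= addbN; set b := i (+) odd (size w).
case: b; last by congr cons; exact/esym/nact_kcons.
by case: x => [[] x2]; congr cons; exact/esym/nact_acons.
Qed.

Lemma nact_nil g : nact g [::] = [::].
Proof. by case: g => x w; elim: w x => //= y w IH x; rewrite /nact /= [nact_rec _ _ _]IH. Qed.

Fixpoint nleaves (k : nat) (g : nform) : seq nform :=
  if k is k'.+1 then nleaves k' (nsec true g) ++ nleaves k' (nsec false g)
  else [:: g].

(** The portrait above level [k]: whether the two subtrees are swapped, at each of the 2^k - 1 inner
    vertices. *)
Fixpoint nbits (k : nat) (g : nform) : seq bool :=
  if k is k'.+1 then
    odd (size g.2) :: nbits k' (nsec true g) ++ nbits k' (nsec false g)
  else [::].

Lemma size_nleaves k g : size (nleaves k g) = (2 ^ k)%N.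
Proof. by elim: k g => //= k IH g; rewrite size_cat !IH expnS mul2n addnn. Qed.

Lemma size_nbits k g : (size (nbits k g)).+1 = (2 ^ k)%N.
Proof.
elim: k g => //= k IH g; rewrite size_cat expnS mul2n -addnn -{1}(IH (nsec true g)).
by rewrite -(IH (nsec false g)) addSn addnS.
Qed.

Lemma nact_ext k g h : nleaves k g = nleaves k h -> nbits k g = nbits k h ->
  nact g =1 nact h.
Proof.
elim: k g h => [|k IH] g h /=; first by move=> [->].
move/eqP; rewrite eqseq_cat ?size_nleaves // => /andP[/eqP l1 /eqP l2].
case=> o /eqP; rewrite eqseq_cat; last first.
  by apply/eqP; rewrite -eqSS !size_nbits.
case/andP=> /eqP b1 /eqP b2 [|i s].
  by rewrite !nact_nil.
rewrite !nact_cons o /=; congr cons.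
by case: (i (+) _); [apply: IH l1 b1 _ | apply: IH l2 b2 _].
Qed.

(* The images of [p] under the prefixes of [x a y1 a ... a ym] ending in a
   Klein letter. *)
Fixpoint norb_rec (x : klein) (w : seq klein) (p : seq bool) : seq (seq bool) :=
  kact x p ::
    if w is y :: w' then [seq kact x (aflip z) | z <- norb_rec y w' p] else [::].
Definition norb (g : nform) := norb_rec g.1 g.2.

Lemma norb_kcons x g p : norb (kcons x g) p = map (kact x) (norb g p).
Proof.
case: g => y [|z w]; rewrite /norb /= kactM //; congr cons.
by rewrite -map_comp; apply: eq_map => s /=; rewrite kactM.
Qed.

Lemma norb_acons g p : norb (acons g) p = p :: map aflip (norb g p).
Proof.
rewrite /norb /= kact1; congr cons; apply: eq_map => s; exact: kact1.
Qed.

Lemma size_norb g p : size (norb g p) = (size g.2).+1.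
Proof.
by case: g => x w; rewrite /norb /=; elim: w x => //= y w IH x; rewrite size_map IH.
Qed.

Definition kfixed (p : seq bool) := forall x, kact x p = p.

Lemma kfixed_true p : kfixed (true :: p) -> kfixed p.
Proof.
(* This Klein letter is the preimage of [x] under the bijection [kphi]. *)
move=> fp x; have := fp (x.1 (+) x.2, x.1).
by case: x => [[] []] [].
Qed.

Lemma mem_norb_self g p : kfixed p -> p \in norb g p.
Proof. by move=> fp; case: g => x [|y w]; rewrite /norb /= fp mem_head. Qed.

(** A prefix acts on the tail through a part of the section at its output letter [j]. The shortest
    prefix yields [p] itself, which lies in every list because Klein letters fix it. *)
Lemma norb_true g p z : kfixed (true :: p) -> z \in norb g (true :: p) ->
  exists (j : bool) z', z = j :: z' /\ z' \in norb (nsec j g) p.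
Proof.
move=> fp; have fp' := kfixed_true fp.
have self h : p \in norb_rec h.1 h.2 p by have := mem_norb_self h fp'.
case: g => x w; rewrite /norb /nsec /=.
elim: w x z => [|y w IH] x z.
  by rewrite inE fp => /eqP->; exists true, p; split; [by []|exact: self].
rewrite [norb_rec _ _ _]/= inE fp' => /orP[/eqP->|].
  by exists true, p; split; [by []|exact: self].
case/mapP=> z1 /IH[j1 [z2 [-> z2in ->]]].
exists (~~ j1) => /=; case: j1 z2in => /= z2in; last first.
  exists (kact (kphi x) z2); split => //.
  by rewrite -/(norb (kcons _ _) _) norb_kcons; apply: map_f.
rewrite /aflip_if; case: ifP => _; last by exists z2.
exists (aflip z2); split=> //.
by rewrite -/(norb (acons _) _) norb_acons inE map_f ?orbT.
Qed.

Fixpoint norb_cover (k : nat) (g : nform) (p : seq bool) : seq (seq bool) :=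
  if k is k'.+1 then
    map (cons true) (norb_cover k' (nsec true g) p) ++
    map (cons false) (norb_cover k' (nsec false g) p)
  else norb g p.

(** Each of the 2^k sections contributes one image more than it has [a]s, so short sections mean few
    prefix images. *)
Lemma size_norb_cover k g p :
  size (norb_cover k g p) = (2 ^ k + sumn [seq size h.2 | h <- nleaves k g])%N.
Proof.
elim: k g => [|k IH] g /=; first by rewrite size_norb addn0 add1n.
by rewrite size_cat !size_map !IH map_cat sumn_cat expnS mul2n -addnn addnACA.
Qed.

Lemma norb_coverP k g p z : kfixed (nseq k true ++ p) ->
  z \in norb g (nseq k true ++ p) -> z \in norb_cover k g p.
Proof.
elim: k g z => //= k IH g z fp.
move/(norb_true fp) => [j [z' [-> /(IH _ _ (kfixed_true fp)) z'in]]].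
by rewrite mem_cat; case: j z'in => z'in; rewrite (map_f _ z'in) ?orbT.
Qed.

Lemma kfixed_nseq n : kfixed (nseq n true).
Proof. by elim: n => //= n IH x /=; rewrite IH. Qed.

Lemma kfixed_nseq_false n : kfixed (nseq n true ++ [:: false]).
Proof.
elim: n => [|n IH] x /=; last by rewrite IH.
by rewrite /aflip_if; case: x.1.
Qed.

(* [None] is the letter [a]. *)
Definition qletter : Type := option klein.
Definition qact1 (c : qletter) : seq bool -> seq bool :=
  if c is Some x then kact x else aflip.
Definition qact (w : seq qletter) (s : seq bool) := foldr qact1 s w.

Lemma qact1K c : involutive (qact1 c).
Proof. by case: c => [x|]; [exact: kactK | exact: aflipK]. Qed.

Lemma size_qact1 c s : size (qact1 c s) = size s.
Proof. by case: c => [x|] /=; [exact: size_kact | exact: size_aflip]. Qed.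

Definition qcons (c : qletter) (g : nform) : nform :=
  if c is Some x then kcons x g else acons g.
Definition qnorm (w : seq qletter) : nform := foldr qcons (kone, [::]) w.

Lemma nact_qnorm w s : nact (qnorm w) s = qact w s.
Proof.
elim: w => [|[x|] w IH] /=; first by rewrite /nact /= kact1.
  by rewrite nact_kcons IH.
by rewrite nact_acons IH.
Qed.

(** As Klein letters fix [p], any prefix has the same image of [p] as a prefix of the normal form
    that ends in a Klein letter. *)
Lemma qact_prefix_norb w1 w2 p : kfixed p -> qact w1 p \in norb (qnorm (w1 ++ w2)) p.
Proof.
move=> fp; elim: w1 => [|[x|] w IH] /=; first exact: mem_norb_self.
  by rewrite norb_kcons map_f.
by rewrite norb_acons inE map_f ?orbT.
Qed.

(* The distance from [1^n] along the Schreier graph of level [n], which is a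
   path. *)
Fixpoint gpos (s : seq bool) : nat :=
  if s is i :: s' then (2 * gpos s' + (odd (gpos s') (+) ~~ i))%N else 0%N.

Lemma odd_gpos_cons i s : odd (gpos (i :: s)) = odd (gpos s) (+) ~~ i.
Proof. by rewrite /= oddD oddM /= oddb. Qed.

Lemma gpos_aflip s : (0 < size s)%N ->
  gpos (aflip s) = if odd (gpos s) then (gpos s).-1 else (gpos s).+1.
Proof.
case: s => // i s _; rewrite odd_gpos_cons [aflip _]/= [gpos _]/= [in RHS]/=.
by case: i; case: (odd (gpos s)) => /=; lia.
Qed.

(** The edges of the path alternate: [a] exchanges 2i and 2i+1, Klein letters move only between 2i+1
    and 2i+2. Below [true], such an edge of the tail becomes the edge from 4i+3 to 4i+4; below
    [false], an [a]-edge of the tail becomes the edge from 4i+1 to 4i+2. *)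
Lemma gpos_kact x s :
  [\/ gpos (kact x s) = gpos s,
      odd (gpos s) /\ gpos (kact x s) = (gpos s).+1 |
      ~~ odd (gpos s) /\ (gpos (kact x s)).+1 = gpos s].
Proof.
elim: s x => [|i s IH] x; first by constructor 1.
rewrite odd_gpos_cons; case: i => /=.
  case: (IH (kphi x)) => [-> | [od E] | [od E]].
  - by constructor 1.
  - by constructor 2; rewrite E /= od; split => //=; lia.
  by constructor 3; rewrite -E /= in od *; rewrite (negbNE od); split => //=; lia.
rewrite /aflip_if; case: x.1; last by constructor 1.
case: (eqVneq s [::]) => [->|s0]; first by constructor 1.
have /gpos_aflip : (0 < size s)%N by case: (s) s0.
move: (gpos (aflip s)) (gpos s) => m' m; case: ifP => om ->.
  constructor 3; split=> //; case: m om => //= m om; rewrite (negbTE om) /=; lia.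
by constructor 2; rewrite /= om; split=> //=; lia.
Qed.

Lemma gpos_qact1 c s : (gpos (qact1 c s) <= (gpos s).+1)%N /\
  (gpos s <= (gpos (qact1 c s)).+1)%N.
Proof.
case: c => [x|] /=.
  by case: (gpos_kact x s) => [-> | [_ ->] | [_ <-]]; split; lia.
case: s => // i s; rewrite gpos_aflip //; case: ifP => _; split; lia.
Qed.

Lemma gpos_qact w s : (gpos (qact w s) <= gpos s + size w)%N /\
  (gpos s <= gpos (qact w s) + size w)%N.
Proof.
elim: w => [|c w [IH1 IH2]] /=; first by rewrite addn0.
by have [H1 H2] := gpos_qact1 c (qact w s); split; lia.
Qed.

Lemma gpos_nseq n : gpos (nseq n true) = 0%N.
Proof. by elim: n => //= n ->. Qed.

Lemma gpos_nseq_false n : gpos (nseq n true ++ [:: false]) = (2 ^ n.+1).-1.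
Proof.
elim: n => // n IH; rewrite [nseq _ _ ++ _]/= [gpos _]/= {}IH.
have : (0 < 2 ^ n.+1)%N by rewrite expn_gt0.
rewrite [in RHS]expnS; have : odd (2 ^ n.+1) = false by rewrite oddX.
move: (2 ^ n.+1)%N => m om mp; have -> : odd m.-1 by case: m om mp => //= m /negbFE.
by rewrite /=; lia.
Qed.

Lemma gpos_kact_lt s : ~~ odd (gpos s) -> (0 < gpos s)%N ->
  exists x, (gpos (kact x s) < gpos s)%N.
Proof.
elim: s => // i s IH; rewrite odd_gpos_cons [gpos _]/=; case: i => /=.
  rewrite addbF => od; rewrite (negbTE od) addn0 muln_gt0 /= => g0.
  have [[x1 x2] xlt] := IH od g0.
  exists (x1 (+) x2, x1); rewrite (_ : kphi _ = (x1, x2)); last by case: x1 x2 {xlt} => [] [].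
  by have := leq_b1 (odd (gpos (kact (x1, x2) s))); rewrite addbF; lia.
rewrite addbT negbK => od _; exists (true, true) => /=.
have /gpos_aflip -> : (0 < size s)%N by case: (s) od.
by rewrite od; case: (gpos s) od => //= m om; rewrite addbT om; lia.
Qed.

Lemma gpos_eq0 s : gpos s = 0%N -> s = nseq (size s) true.
Proof.
elim: s => // i s IH /= g0; have gs : gpos s = 0%N by lia.
by move: g0; rewrite gs -IH //; case: i.
Qed.

(** Walk down the path to position 0: by [a] from odd positions, by a suitable Klein letter from
    even ones. *)
Lemma qact_transitive s : exists w, qact w s = nseq (size s) true.
Proof.
have [m] := ubnP (gpos s); elim: m s => // m IH s; rewrite ltnS => sm.
have [g0|g0] := posnP (gpos s); first by exists [::]; exact: gpos_eq0.
have [c clt] : exists c, (gpos (qact1 c s) < gpos s)%N.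
  case: (boolP (odd (gpos s))) => od; last first.
    by have [x xlt] := gpos_kact_lt od g0; exists (Some x).
  exists None; rewrite /= gpos_aflip ?od ?prednK //.
  by case: (s) g0.
have [w wE] := IH _ (leq_trans clt sm).
by exists (w ++ [:: c]); rewrite /qact foldr_cat -/(qact w _) wE size_qact1.
Qed.

(** * Bartholdi's weights and the contraction of sections *)

Section Weights.
Variables (R : realType) (e : R).
Hypothesis e01 : 0 < e < 1.
Hypothesis eE : e ^+ 3 + e ^+ 2 + e = 2.

(* With [a] weighing [1 - e^3], these weights make the decomposition of
   [a x], for [x] one of [b], [c], [d], contract by exactly [e]. *)
Definition kwt (x : klein) : R :=
  match x with
  | (true, true) => e ^+ 3
  | (true, false) => 1 - e ^+ 2
  | (false, _) => 1 - e
  end.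
Definition awt : R := 1 - e ^+ 3.

Definition nwt (g : nform) : R := kwt g.1 + \sum_(y <- g.2) (awt + kwt y).

Let e_gt0 : 0 < e. Proof. by case/andP: e01. Qed.
Let e_lt1 : e < 1. Proof. by case/andP: e01. Qed.
Let e2_gt0 : 0 < e ^+ 2. Proof. exact: exprn_gt0. Qed.
Let e2_lt1 : e ^+ 2 < 1. Proof. by rewrite exprn_ilt1 // ltW. Qed.
Let e2_lt : e ^+ 2 < e. Proof. by rewrite expr2 -[ltRHS]mulr1 ltr_pM2l. Qed.
Let e3_gt0 : 0 < e ^+ 3. Proof. exact: exprn_gt0. Qed.
Let e3_lt1 : e ^+ 3 < 1. Proof. by rewrite exprn_ilt1 // ltW. Qed.
Let e4 : e * e ^+ 3 = 2 * e - e ^+ 2 - e ^+ 3.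
Proof.
have h : e * (e ^+ 3 + e ^+ 2 + e) = e * 2 by rewrite eE.
by lra.
Qed.

Local Ltac weights_lra := have := e_gt0; have := e_lt1; have := e2_gt0; have := e2_lt1;
  have := e2_lt; have := e3_gt0; have := e3_lt1; have := eE; have := e4; lra.

Lemma kwt_gt0 x : 0 < kwt x.
Proof. by case: x => [[] []] /=; weights_lra. Qed.

Lemma kwt_le1 x : kwt x <= 1.
Proof. by case: x => [[] []] /=; weights_lra. Qed.

Lemma awt_gt0 : 0 < awt. Proof. rewrite /awt; weights_lra. Qed.

Lemma kwtM x y : kwt (kmul x y) <= kwt x + kwt y.
Proof. by case: x => [[] []]; case: y => [[] []] /=; weights_lra. Qed.

(** Equality holds for the three nontrivial letters; the trivial one, weighing as much as d, leaves
    slack. *)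
Lemma kwt_contract x :
  kwt (kphi x) + (if x.1 then awt else 0) <= e * (awt + kwt x).
Proof.
by case: x => [[] []]; rewrite /awt /=; weights_lra.
Qed.

Lemma nwt_kcons x g : nwt (kcons x g) <= kwt x + nwt g.
Proof. by rewrite /nwt addrA lerD2r; exact: kwtM. Qed.

Lemma nwt_acons g : nwt (acons g) = kwt kone + awt + nwt g.
Proof. by rewrite /nwt /= big_cons !addrA. Qed.

Lemma nwt_kcons_acons x g : nwt (kcons x (acons g)) = kwt x + (awt + nwt g).
Proof. by rewrite /kcons kmulk1 /nwt big_cons /= !addrA. Qed.

Lemma nwt_nil x : nwt (x, [::]) = kwt x.
Proof. by rewrite /nwt big_nil addr0. Qed.

(** The weight of the section at [j] before adjacent Klein letters are merged, with a trivial letter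
    closing the word. *)
Fixpoint scost (j : bool) (x : klein) (w : seq klein) : R :=
  (if j then kwt (kphi x) else if x.1 then awt else 0) +
  if w is y :: w' then scost (~~ j) y w' else kwt kone.

(** Merging lowers weight by [kwtM]. In the second clause the letter [y] absorbs the trivial letter
    that [acons] puts in front, whose weight [scost] does not count. *)
Lemma nsec_scost x w : nwt (nsec_rec true x w) <= scost true x w /\
  forall y, nwt (kcons y (nsec_rec false x w)) <= kwt y + scost false x w.
Proof.
elim: w x => [|z w IH] x.
  rewrite [nsec_rec _ _ _]/= [nsec_rec false _ _]/= [scost true _ _]/= [scost false _ _]/=.
  split=> [|y]; first by have := nwt_kcons (kphi x) (kone, [::]); rewrite nwt_nil.
  case: (x.1); first by rewrite nwt_kcons_acons nwt_nil.
  by rewrite add0r; have := nwt_kcons y (kone, [::]); rewrite nwt_nil.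
have [IH1 IH0] := IH z; split=> [|y]; first exact: IH0.
rewrite [nsec_rec _ _ _]/= [scost _ _ _]/=; case: (x.1).
  by rewrite nwt_kcons_acons !lerD2l.
by rewrite add0r; apply: le_trans (nwt_kcons _ _) _; rewrite lerD2l.
Qed.

(** Each Klein letter sends [kphi x] to one section and possibly [a] to the other, so [kwt_contract]
    applies letter by letter. The extra [awt] is for the first letter, which has no [a] before
    it. *)
Lemma scostD x w : scost true x w + scost false x w <=
  e * (nwt (x, w) + awt) + 2 * kwt kone.
Proof.
elim: w x => [|y w IH] x.
  rewrite nwt_nil; have := kwt_contract x; rewrite (addrC awt).
  have -> : scost true x [::] = kwt (kphi x) + kwt kone by [].
  have -> : scost false x [::] = (if x.1 then awt else 0) + kwt kone by [].
  by move: (kwt (kphi x)) (kwt kone) (kwt x) (if _ then _ else _) => *; lra.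
have -> : nwt (x, y :: w) = kwt x + (awt + nwt (y, w)).
  by rewrite /nwt big_cons /= !addrA.
have -> : scost true x (y :: w) = kwt (kphi x) + scost false y w by [].
have -> : scost false x (y :: w) = (if x.1 then awt else 0) + scost true y w by [].
have := IH y; have := kwt_contract x; rewrite !mulrDr.
by move: (kwt (kphi x)) (kwt kone) (if _ then _ else _) => *; lra.
Qed.

(** The additive error is [e * awt + 3 * kwt kone], which is below 4. *)
Lemma nwt_sec g : nwt (nsec true g) + nwt (nsec false g) <= e * nwt g + 4.
Proof.
case: g => x w; have [H1 H0] := nsec_scost x w.
have H2 := scostD x w; have := H0 kone.
have -> : kcons kone (nsec_rec false x w) = nsec_rec false x w.
  by case: (nsec_rec _ _ _) => y l; rewrite /kcons kmul1k.
rewrite /nsec /=; move: H2; rewrite mulrDr /awt mulrBr mulr1 e4 /=; weights_lra.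
Qed.

(** Each inner vertex adds an error of at most 4, which later levels only contract, and there are
    2^k - 1 of them. *)
Lemma nwt_leaves k g :
  \sum_(h <- nleaves k g) nwt h <= e ^+ k * nwt g + 4 * (2 ^+ k - 1).
Proof.
elim: k g => [|k IH] g; first by rewrite /= big_seq1 expr0 mul1r expr0 subrr mulr0 addr0.
rewrite [nleaves _ _]/= big_cat /=; apply: le_trans (lerD (IH _) (IH _)) _.
have := nwt_sec g; set u := nwt (nsec true g); set v := nwt (nsec false g) => uv.
have ek : 0 <= e ^+ k <= 1.
  by case/andP: e01 => *; rewrite exprn_ge0 ?exprn_ile1 // ltW.
have /(ler_wpM2l (proj1 (andP ek))) : u + v <= e * nwt g + 4 by [].
rewrite exprSr (exprS 2) !mulrDr mulrA; weights_lra.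
Qed.

Lemma size_leaves k g :
  awt * (sumn [seq size h.2 | h <- nleaves k g])%:R <=
    \sum_(h <- nleaves k g) nwt h.
Proof.
elim: (nleaves k g) => [|h s IH]; first by rewrite big_nil /= mulr0.
rewrite /= big_cons natrD mulrDr; apply: lerD => //.
rewrite /nwt; apply: ler_wpDl; first exact/ltW/kwt_gt0.
elim: (h.2) => [|y w IHw]; first by rewrite big_nil mulr0.
rewrite /= big_cons -natr1 mulrDr mulr1; have := kwt_gt0 y; weights_lra.
Qed.

(** Every letter adds at most 1: for [a] together with its trivial Klein letter the weight is 2 - e
    - e^3 = e^2. *)
Lemma nwt_qnorm w : nwt (qnorm w) <= (size w).+1%:R.
Proof.
elim: w => [|[x|] w IH] /=; first by rewrite /nwt /= big_nil addr0; weights_lra.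
  by apply: le_trans (nwt_kcons _ _) _; have := kwt_le1 x; rewrite -natr1; weights_lra.
by rewrite nwt_acons -natr1 /awt /=; weights_lra.
Qed.

End Weights.

(** * Counting codes *)

(** The code is a relation, so no canonical word has to be chosen for an element. *)
Lemma card_fset_set_le (T : choiceType) (X : set T) (D : finType)
    (code : D -> T -> Prop) : finite_set X ->
  (forall x, X x -> exists d, code d x) ->
  (forall d x y, code d x -> code d y -> x = y) ->
  (#|` fset_set X| <= #|D|)%N.
Proof.
move=> fX Xcode code_inj.
have [->|/fset0Pn[x0]] := eqVneq (fset_set X) fset0; first by rewrite cardfs0.
rewrite in_fset_set // inE => Xx0.
pose f d := xget x0 [set x | code d x].
rewrite cardE -(size_map f); apply: uniq_leq_size (fset_uniq _) _ => x.
rewrite in_fset_set // inE => /Xcode[d dx]; apply/mapP; exists d.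
  by rewrite mem_enum.
by rewrite /f; case: xgetP => [y -> /(code_inj _ _ _ dx)|/(_ x)].
Qed.

Section Padding.
Variables (T : Type) (x0 : T) (n : nat).

Definition pad (s : seq T) : n.-tuple T := [tuple nth x0 s i | i < n].

Lemma nth_pad s i : (i < n)%N -> nth x0 (pad s) i = nth x0 s i.
Proof. by move=> lt; rewrite -[i]/(val (Ordinal lt)) -tnth_nth tnth_mktuple. Qed.

Lemma pad_inj s s' : size s = size s' -> (size s <= n)%N -> pad s = pad s' -> s = s'.
Proof.
move=> ss' sn E; apply: (@eq_from_nth _ x0) => // i lt.
by rewrite -(nth_pad s) ?(leq_trans lt) // E nth_pad // (leq_trans lt).
Qed.

End Padding.

Section SparseFunctions.
Variables (I : eqType) (V : Type) (b : I -> V) (i0 : I) (n : nat).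

(** The padding is itself a pair on the graph of [F], so every entry of the tuple is a true value of
    [F]. *)
Definition sparse_code (L : seq I) (F : I -> V) : n.-tuple (I * V) :=
  pad (i0, F i0) n [seq (i, F i) | i <- L].

Lemma sparse_code_inj L L' F F' : (size L <= n)%N -> (size L' <= n)%N ->
  (forall i, i \notin L -> F i = b i) -> (forall i, i \notin L' -> F' i = b i) ->
  sparse_code L F = sparse_code L' F' -> F =1 F'.
Proof.
have one_side M M' G G' i : (size M <= n)%N -> sparse_code M G = sparse_code M' G' ->
    i \in M -> G i = G' i.
  move=> sM E iM; have lt : (index i M < n)%N by rewrite (leq_trans _ sM) // index_mem.
  have : nth (i0, G i0) (sparse_code M G) (index i M) = (i, G i).
    by rewrite nth_pad // (nth_map i) ?index_mem // nth_index.
  rewrite E (set_nth_default (i0, G' i0)) ?size_tuple // nth_pad //.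
  have [lt'|ge'] := ltnP (index i M) (size M'); last first.
    by rewrite nth_default ?size_map // => -[-> ->].
  by rewrite (nth_map i) // => -[-> ->].
move=> sL sL' FL FL' E i.
have [iL|iL] := boolP (i \in L); first exact: one_side sL E iL.
have [iL'|iL'] := boolP (i \in L'); first by apply/esym; exact: one_side sL' (esym E) iL'.
by rewrite FL // FL'.
Qed.

End SparseFunctions.

Definition tail_total (k : nat) (f : nform) : nat :=
  sumn [seq size x.2 | x <- nleaves k f].

Section LeafCode.
Variables (k B : nat).

(** Portrait, leading Klein letters of the sections, lengths of their tails, and all tails
    concatenated. Bounding the total length by [B] makes the last factor 4^B only. *)
Definition leaf_code : finType :=
  ((2 ^ k).-tuple bool * (2 ^ k).-tuple klein *
   (2 ^ k).-tuple 'I_B.+1 * B.-tuple klein)%type.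

Definition nform_code (f : nform) : leaf_code :=
  (pad false (2 ^ k) (nbits k f),
   pad kone (2 ^ k) [seq x.1 | x <- nleaves k f],
   pad ord0 (2 ^ k) [seq inord (size x.2) | x <- nleaves k f],
   pad kone B (flatten [seq x.2 | x <- nleaves k f])).

Lemma nform_code_inj f f' : (tail_total k f <= B)%N -> (tail_total k f' <= B)%N ->
  nform_code f = nform_code f' -> nact f =1 nact f'.
Proof.
move=> fB fB' E.
have sb h : (size (nbits k h) <= 2 ^ k)%N by rewrite -(size_nbits k h).
have sb' : size (nbits k f) = size (nbits k f').
  by apply/eqP; rewrite -eqSS !size_nbits.
have /= /(pad_inj sb' (sb f)) bE := congr1 (fun d : leaf_code => d.1.1.1) E.
have hE : [seq x.1 | x <- nleaves k f] = [seq x.1 | x <- nleaves k f'].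
  have := congr1 (fun d : leaf_code => d.1.1.2) E.
  by apply: pad_inj; rewrite !size_map !size_nleaves.
have sE : [seq (inord (size x.2) : 'I_B.+1) | x <- nleaves k f] =
    [seq inord (size x.2) | x <- nleaves k f'].
  have := congr1 (fun d : leaf_code => d.1.2) E.
  by apply: pad_inj; rewrite !size_map !size_nleaves.
have shE : [seq size x.2 | x <- nleaves k f] = [seq size x.2 | x <- nleaves k f'].
  have le h : (tail_total k h <= B)%N ->
      [seq size x.2 | x <- nleaves k h] =
      map val [seq (inord (size x.2) : 'I_B.+1) | x <- nleaves k h].
    move=> hB; rewrite -map_comp; apply/eq_in_map => x xh /=; rewrite inordK // ltnS.
    apply: leq_trans hB; rewrite /tail_total; elim: (nleaves k h) xh => //= y s IH.
    by rewrite inE => /orP[/eqP->|/IH]; lia.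
  by rewrite !le // sE.
have shE' : shape [seq x.2 | x <- nleaves k f] = shape [seq x.2 | x <- nleaves k f'].
  by rewrite /shape -!map_comp.
have flE : flatten [seq x.2 | x <- nleaves k f] = flatten [seq x.2 | x <- nleaves k f'].
  have := congr1 (fun d : leaf_code => d.2) E.
  by apply: pad_inj; rewrite !size_flatten ?shE' // -shE' /shape -map_comp.
have tE : [seq x.2 | x <- nleaves k f] = [seq x.2 | x <- nleaves k f'].
  by rewrite -(flattenK [seq x.2 | x <- nleaves k f]) flE shE' flattenK.
apply: nact_ext bE.
by rewrite -(zip_unzip (nleaves k f)) -(zip_unzip (nleaves k f')) /unzip1 /unzip2 hE tE.
Qed.

Lemma card_leaf_code :
  #|leaf_code| = (2 ^ 2 ^ k * 4 ^ 2 ^ k * B.+1 ^ 2 ^ k * 4 ^ B)%N.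
Proof. by rewrite !card_prod !card_tuple !card_prod card_bool card_ord. Qed.

End LeafCode.

(** * Elementary matrices and even permutations *)

Inductive mclos (B : pzRingType) (X : B -> Prop) : B -> Prop :=
| mclos_one : mclos X 1
| mclos_cons x y : X x -> mclos X y -> mclos X (x * y).

Section MonoidClosure.
Variable B : pzRingType.
Implicit Types (X : B -> Prop) (x y u v : B).

Lemma mclos_in X x : X x -> mclos X x.
Proof. by move=> Xx; rewrite -[x]mulr1; apply: mclos_cons => //; exact: mclos_one. Qed.

Lemma mclos_mul X x y : mclos X x -> mclos X y -> mclos X (x * y).
Proof.
move=> cx cy; elim: cx => [|a b Xa _ IH]; first by rewrite mul1r.
by rewrite -mulrA; apply: mclos_cons.
Qed.

Lemma mclos_conj X u v x : v * u = 1 -> u * v = 1 ->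
  (forall y, X y -> mclos X (u * y * v)) -> mclos X x -> mclos X (u * x * v).
Proof.
move=> vu uv Xc; elim=> [|a b Xa _ IH]; first by rewrite mulr1 uv; exact: mclos_one.
have -> : u * (a * b) * v = (u * a * v) * (u * b * v).
  by rewrite !mulrA -(mulrA _ v u) vu mulr1.
by apply: mclos_mul => //; exact: Xc.
Qed.

End MonoidClosure.

Section IndexedMatrices.
Variables (A : pzRingType) (m : nat) (P : finType) (g : 'I_m -> P) (h : P -> 'I_m).
Hypotheses (gK : cancel g h) (hK : cancel h g).
Implicit Types (p q : P) (r : A) (s t : {perm P}).

Definition mxf (F : P -> P -> A) : 'M[A]_m := \matrix_(i, j) F (g i) (g j).

Lemma eq_mxf F F' : (forall p q, F p q = F' p q) -> mxf F = mxf F'.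
Proof. by move=> FF'; apply/matrixP => i j; rewrite !mxE FF'. Qed.

Lemma mxfM F F' : mxf F * mxf F' = mxf (fun p q => \sum_x F p x * F' x q).
Proof.
apply/matrixP => i j; rewrite !mxE (reindex g) /=; last first.
  by exists h => ? _; rewrite ?gK ?hK.
by apply: eq_bigr => k _; rewrite !mxE.
Qed.

Lemma mxf1 : 1 = mxf (fun p q => (p == q)%:R).
Proof.
by apply/matrixP => i j; rewrite !mxE (inj_eq (can_inj gK)).
Qed.

Lemma mxfD F F' : mxf F + mxf F' = mxf (fun p q => F p q + F' p q).
Proof. by apply/matrixP => i j; rewrite !mxE. Qed.

Lemma mxfN F : - mxf F = mxf (fun p q => - F p q).
Proof. by apply/matrixP => i j; rewrite !mxE. Qed.

Lemma mxf0 : 0 = mxf (fun _ _ => 0).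
Proof. by apply/matrixP => i j; rewrite !mxE. Qed.

Definition unit_mx p q r := mxf (fun a b => if (a == p) && (b == q) then r else 0).
Definition elem_mx p q r := 1 + unit_mx p q r.
(** Row [a] has its 1 in column [s a]; this suits the product of permutations that applies the left
    factor first. *)
Definition pmx s := mxf (fun a b => (s a == b)%:R).

Lemma unit_mxM p q p' q' r r' :
  unit_mx p q r * unit_mx p' q' r' = if q == p' then unit_mx p q' (r * r') else 0.
Proof.
rewrite mxfM; case: eqVneq => [<-|qp']; rewrite ?mxf0; apply: eq_mxf => a b.
  rewrite (bigD1 q) //= !eqxx andbT big1 ?addr0; last first.
    by move=> x /negPf xq; rewrite xq andbF mul0r.
  by case: (a == p); case: (b == q'); rewrite ?mulr0 ?mul0r.
apply: big1 => x _; case: (eqVneq x q) => [->|]; last by rewrite andbF mul0r.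
by rewrite (negPf qp') mulr0.
Qed.

Lemma unit_mxD p q r r' : unit_mx p q r + unit_mx p q r' = unit_mx p q (r + r').
Proof. by rewrite mxfD; apply: eq_mxf => a b; case: ifP; rewrite ?addr0. Qed.

Lemma unit_mx0 p q : unit_mx p q 0 = 0.
Proof. by rewrite mxf0; apply: eq_mxf => a b; case: ifP. Qed.

Lemma unit_mxN p q r : unit_mx p q (- r) = - unit_mx p q r.
Proof. by apply/eqP; rewrite -addr_eq0 unit_mxD addNr unit_mx0. Qed.

Lemma elem_mxD p q r r' : p != q ->
  elem_mx p q r * elem_mx p q r' = elem_mx p q (r + r').
Proof.
move=> pq; rewrite /elem_mx mulrDl mul1r mulrDr mulr1 unit_mxM eq_sym (negPf pq).
by rewrite addr0 -addrA unit_mxD (addrC r').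
Qed.

Lemma elem_mx0 p q : elem_mx p q 0 = 1.
Proof. by rewrite /elem_mx unit_mx0 addr0. Qed.

(** Steinberg's commutator relation, with the order of [r] and [r'] kept for noncommutative
    coefficients. *)
Lemma elem_mx_comm p q q' r r' : p != q -> q != q' -> p != q' ->
  elem_mx p q r * elem_mx q q' r' * elem_mx p q (- r) * elem_mx q q' (- r') =
  elem_mx p q' (r * r').
Proof.
move=> pq qq' pq'; rewrite /elem_mx !unit_mxN.
set X := unit_mx p q r; set Y := unit_mx q q' r'.
have XX : X * X = 0 by rewrite unit_mxM eq_sym (negPf pq).
have YY : Y * Y = 0 by rewrite unit_mxM eq_sym (negPf qq').
have YX : Y * X = 0 by rewrite unit_mxM eq_sym (negPf pq').
have <- : X * Y = unit_mx p q' (r * r') by rewrite unit_mxM eqxx.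
have -> : (1 + X) * (1 + Y) * (1 - X) = 1 + Y + X * Y.
  rewrite mulrBr mulr1 (mulrDl 1 X) mul1r mulrDr mulr1 !mulrDl mul1r -(mulrA X).
  by rewrite YX XX mulr0 !addr0 -(addrA (1 + Y)) (addrC X) addrK.
by rewrite mulrBr mulr1 !mulrDl mul1r -mulrA YY mulr0 !addr0 addrAC addrK.
Qed.

Lemma pmx1 : pmx 1%g = 1.
Proof. by rewrite mxf1; apply: eq_mxf => a b; rewrite perm1. Qed.

Lemma pmx_mxf s F : pmx s * mxf F = mxf (fun p q => F (s p) q).
Proof.
rewrite mxfM; apply: eq_mxf => a b; rewrite (bigD1 (s a)) //= eqxx mul1r big1 ?addr0 //.
by move=> x; rewrite eq_sym => /negPf->; rewrite mul0r.
Qed.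

Lemma mxf_pmx s F : mxf F * pmx s = mxf (fun p q => F p (s^-1%g q)).
Proof.
rewrite mxfM; apply: eq_mxf => a b; rewrite (bigD1 (s^-1%g b)) //= permKV eqxx mulr1.
rewrite big1 ?addr0 // => x xb; case: eqP => [sx|]; last by rewrite mulr0.
by rewrite -sx permK eqxx in xb.
Qed.

Lemma pmxM s t : pmx (s * t)%g = pmx s * pmx t.
Proof. by rewrite pmx_mxf; apply: eq_mxf => a b; rewrite permM. Qed.

Lemma pmx_unit s p q r : pmx s * unit_mx (s p) (s q) r = unit_mx p q r * pmx s.
Proof.
rewrite pmx_mxf mxf_pmx; apply: eq_mxf => a b.
by rewrite (inj_eq perm_inj) -{1}(permKV s b) (inj_eq perm_inj).
Qed.

Lemma pmx_elem s p q r : pmx s * elem_mx (s p) (s q) r = elem_mx p q r * pmx s.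
Proof. by rewrite /elem_mx mulrDr mulrDl mulr1 mul1r pmx_unit. Qed.

(** The diagonal sign change at [p]. It corrects the sign of a transposition, which alone need not
    be a product of elementary matrices. *)
Definition refl_mx p := mxf (fun a b => if a == b then (if a == p then -1 else 1) else 0).

Lemma refl_mxf p F : refl_mx p * mxf F = mxf (fun a b => if a == p then - F a b else F a b).
Proof.
rewrite mxfM; apply: eq_mxf => a b; rewrite (bigD1 a) //= eqxx big1 ?addr0.
  by case: ifP; rewrite ?mulN1r ?mul1r.
by move=> x; rewrite eq_sym => /negPf->; rewrite mul0r.
Qed.

Lemma mxf_refl p F : mxf F * refl_mx p = mxf (fun a b => if b == p then - F a b else F a b).
Proof.
rewrite mxfM; apply: eq_mxf => a b; rewrite (bigD1 b) //= eqxx big1 ?addr0.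
  by case: ifP; rewrite ?mulrN1 ?mulr1.
by move=> x /negPf->; rewrite mulr0.
Qed.

Lemma refl_mxK p : refl_mx p * refl_mx p = 1.
Proof.
rewrite refl_mxf mxf1; apply: eq_mxf => a b.
by case: (a == b); case: (a == p); rewrite ?opprK ?oppr0.
Qed.

Lemma pmx_refl s p : pmx s * refl_mx (s p) = refl_mx p * pmx s.
Proof.
rewrite pmx_mxf refl_mxf; apply: eq_mxf => a b.
by rewrite (inj_eq perm_inj); case: (a == p); case: (_ == b); rewrite ?oppr0.
Qed.

Lemma refl_elem_refl p a b r : exists r', refl_mx p * elem_mx a b r * refl_mx p = elem_mx a b r'.
Proof.
exists (if a == p then (if b == p then r else - r) else (if b == p then - r else r)).
rewrite /elem_mx mulrDr mulr1 mulrDl refl_mxK refl_mxf mxf_refl; congr (1 + _).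
apply: eq_mxf => x y; case: (eqVneq x a) => [->|] /=.
  case: (eqVneq y b) => [->|] /=; case: (a == p); case: ifP; rewrite ?opprK ?oppr0 //.
by case: (x == p); case: (y == p); rewrite ?opprK ?oppr0.
Qed.

Definition elem_prod : 'M[A]_m -> Prop :=
  mclos (fun M => exists p q r, p != q /\ M = elem_mx p q r).

Lemma elem_mx_prod p q r : p != q -> elem_prod (elem_mx p q r).
Proof. by move=> pq; apply: mclos_in; exists p, q, r. Qed.

Lemma tperm_elem p q : p != q -> elem_prod (pmx (tperm p q) * refl_mx p).
Proof.
move=> pq; have qp : q != p by rewrite eq_sym.
suff -> : pmx (tperm p q) * refl_mx p = elem_mx p q 1 * elem_mx q p (-1) * elem_mx p q 1.
  by apply: mclos_mul; [apply: mclos_mul|]; exact: elem_mx_prod.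
have -> : elem_mx p q 1 * elem_mx q p (-1) * elem_mx p q 1 =
    1 + unit_mx p q 1 - unit_mx q p 1 - unit_mx p p 1 - unit_mx q q 1.
  rewrite /elem_mx !unit_mxN; set X := unit_mx p q 1; set Y := unit_mx q p 1.
  have XX : X * X = 0 by rewrite unit_mxM (negPf qp).
  have XY : X * Y = unit_mx p p 1 by rewrite unit_mxM eqxx mulr1.
  have YX : Y * X = unit_mx q q 1 by rewrite unit_mxM eqxx mulr1.
  have XYX : unit_mx p p 1 * X = X by rewrite unit_mxM eqxx mulr1.
  have -> : (1 + X) * (1 - Y) = 1 + X - Y - unit_mx p p 1.
    by rewrite mulrBr mulr1 mulrDl mul1r XY opprD addrA.
  rewrite mulrDr mulr1 !mulrBl mulrDl mul1r XX YX XYX addr0.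
  by rewrite (addrAC X) subrr add0r.
rewrite mxf_refl mxf1 !mxfN !mxfD; apply: eq_mxf => a b.
have pq' := negPf pq; have qp' := negPf qp.
case: tpermP => [->|->|/eqP/negPf ap /eqP/negPf aq].
- rewrite eqxx pq' /= (eq_sym q b) (eq_sym p b).
  case: (eqVneq b p) => [->|bp]; rewrite ?pq' /= ?mulr0n ?mulr1n ?oppr0 ?addr0 ?add0r.
    by rewrite subrr.
  by case: (b == q).
- rewrite eqxx qp' /= (eq_sym q b) (eq_sym p b).
  case: (eqVneq b p) => [->|bp]; rewrite ?pq' /= ?mulr0n ?mulr1n ?oppr0 ?addr0 ?add0r //.
  by case: (b == q); rewrite /= ?mulr0n ?mulr1n ?subrr ?oppr0 ?addr0.
rewrite ap aq /= oppr0 !addr0; case: (eqVneq b p) => // ->.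
by rewrite ap oppr0.
Qed.

(** The square of the signed transposition of [p] and [q] changes both signs. *)
Lemma refl_refl_elem p q : elem_prod (refl_mx p * refl_mx q).
Proof.
have [->|pq] := eqVneq p q; first by rewrite refl_mxK; exact: mclos_one.
have qp : q != p by rewrite eq_sym.
have E := pmx_refl (tperm q p) p; rewrite tpermR in E.
have := mclos_mul (tperm_elem qp) (tperm_elem qp).
by rewrite {1}E mulrA -(mulrA _ (pmx _) (pmx _)) -pmxM tperm2 pmx1 mulr1.
Qed.

(** Each transposition is made signed and its sign moved to the fixed point [p0], where signs cancel
    in pairs; only the parity of their number remains. *)
Lemma prod_tperm_elem p0 (ts : seq (P * P)) : all perm.dpair ts ->
  elem_prod (pmx (\prod_(t <- ts) tperm t.1 t.2)%g *
    (if odd (size ts) then refl_mx p0 else 1)).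
Proof.
elim: ts => [|[p q] ts IH] /=.
  by rewrite big_nil pmx1 mulr1 => _; exact: mclos_one.
case/andP=> pq /IH {}IH; rewrite big_cons pmxM /=.
set M := pmx _ in IH *; set d := if odd (size ts) then _ else _ in IH.
have dd : d * d = 1 by rewrite /d; case: ifP; rewrite ?refl_mxK ?mulr1.
have -> : (if ~~ odd (size ts) then refl_mx p0 else 1) = d * refl_mx p0.
  by rewrite /d; case: (odd _); rewrite /= ?refl_mxK ?mul1r.
have -> : pmx (tperm p q) = pmx (tperm p q) * refl_mx p * refl_mx p.
  by rewrite -mulrA refl_mxK mulr1.
have -> : pmx (tperm p q) * refl_mx p * refl_mx p * M * (d * refl_mx p0) =
  (pmx (tperm p q) * refl_mx p) * (refl_mx p * refl_mx p0) *
  (refl_mx p0 * (M * d) * refl_mx p0).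
  by rewrite !mulrA -(mulrA _ (refl_mx p0) (refl_mx p0)) refl_mxK mulr1.
apply: mclos_mul; first apply: mclos_mul.
- exact: tperm_elem.
- exact: refl_refl_elem.
apply: mclos_conj (refl_mxK p0) (refl_mxK p0) _ IH => _ [a [b [r [ab ->]]]].
by have [r' ->] := refl_elem_refl p0 a b r; exact: elem_mx_prod.
Qed.

Lemma even_perm_elem s : ~~ odd_perm s -> elem_prod (pmx s).
Proof.
case: (prod_tpermP s) => ts -> dts; rewrite odd_perm_prod // => /negPf ev.
case: ts dts ev => [_ _|t ts dts ev]; first by rewrite big_nil pmx1; exact: mclos_one.
by have := prod_tperm_elem t.1 dts; rewrite ev mulr1.
Qed.

End IndexedMatrices.

Lemma elem_prod_EL (A : pzRingType) (m : nat) (P : finType) (g : 'I_m -> P)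
  (h : P -> 'I_m) (gK : cancel g h) (hK : cancel h g) (M : 'M[A]_m) :
  elem_prod g M -> exists x : EL A m, GL_val (subgroup_gen_val x) = M.
Proof.
elim=> [|_ N [p [q [r [pq ->]]]] _ [y yN]]; first by exists 1%g.
have inv : elem_mx g p q r \in @invertible 'M[A]_m.
  rewrite inE; exists (elem_mx g p q (- r)).
  by split; rewrite (@elem_mxD _ _ _ _ h) // ?subrr ?addNr (@elem_mx0 _ _ _ g).
have gen : MkGL inv \in generated (@elementary A m).
  rewrite inE => H /= [_ HX]; apply: HX; exists (h p), (h q), r.
  rewrite (inj_eq (can_inj hK)); split=> //=; rewrite /elem_mx; congr (_ + _).
  apply/matrixP => i j; rewrite !mxE -!(can2_eq gK hK).
  by case: (_ && _); rewrite ?mulr1 ?mulr0.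
by exists (SubgroupGen gen * y)%g; rewrite /= yN.
Qed.

(** * The generating set *)

Section Construction.
Variables (A : pzRingType) (N m : nat).
Let Z : finType := N.+1.-tuple bool.
Let P : finType := (Z * (bool * bool))%type.
Variables (g : 'I_m -> P) (h : P -> 'I_m).
Hypotheses (gK : cancel g h) (hK : cancel h g).
Variable S : seq A.
Hypothesis S_opp : forall r, r \in S -> - r \in S.
Hypothesis S_one : 1 \in S.
Hypothesis S_gen :
  smallest (fun B : set A => GRing.subring_closed [in B]) [set` S] = setT.

Definition ztuple_subproof (c : qletter) (z : Z) : size (qact1 c z) == N.+1.
Proof. by rewrite size_qact1 size_tuple. Qed.
Definition zact (c : qletter) (z : Z) : Z := Tuple (ztuple_subproof c z).

Lemma zactK c : involutive (zact c).
Proof. by move=> z; apply/val_inj; rewrite /= qact1K. Qed.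

Definition pact (c : qletter) (p : P) : P := (zact c p.1, p.2).

Lemma pactK c : involutive (pact c).
Proof. by case=> z k; rewrite /pact /= zactK. Qed.

Definition qperm (c : qletter) : {perm P} := perm (inv_inj (pactK c)).

Lemma qpermE c p : qperm c p = pact c p.
Proof. exact: permE. Qed.

Lemma qpermV c : (qperm c)^-1%g = qperm c.
Proof.
apply/permP => p; apply: (@perm_inj _ (qperm c)).
by rewrite permKV !qpermE pactK.
Qed.

(* [qperm c] is a product of two conjugate permutations, one for each value of
   the last coordinate. *)
Lemma even_qperm c : ~~ odd_perm (qperm c).
Proof.
pose f b (p : P) : P := if p.2.2 == b then pact c p else p.
have fK b : involutive (f b).
  move=> [z k]; rewrite /f /=; case E: (k.2 == b); rewrite /= E //.
  by rewrite -[RHS](pactK c).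
pose sw (p : P) : P := (p.1, (p.2.1, ~~ p.2.2)).
have swK : involutive sw by case=> z [k b]; rewrite /sw /= negbK.
pose s b : {perm P} := perm (inv_inj (fK b)); pose t : {perm P} := perm (inv_inj swK).
have -> : qperm c = (s true * s false)%g.
  apply/permP => p; rewrite permM !permE /f; case: p => z [k []] //=.
suff -> : s true = (s false ^ t)%g by rewrite odd_permM odd_permJ addbb.
have tV p : (t^-1)%g p = sw p.
  by apply: (@perm_inj _ t); rewrite permKV permE swK.
apply/permP => p; rewrite -[p in RHS](permKV t) permJ tV !permE.
by rewrite /f /sw /=; case: p => z [k []].
Qed.

Definition zone : Z := nseq_tuple N.+1 true.
Definition zend_subproof : size (nseq N true ++ [:: false]) == N.+1.
Proof. by rewrite size_cat size_nseq addn1. Qed.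
Definition zend : Z := Tuple zend_subproof.

Definition near_end : {pred P} := [pred p | (p.1 == zend) || (p.1 == zact None zend)].

Definition end_perm : {pred {perm P}} :=
  [pred t : {perm P} | ~~ odd_perm t &
    [forall p : P, (p \in near_end) || (t p == p)]].

Lemma end_permP (t : {perm P}) : reflect
  (~~ odd_perm t /\ forall p, p \notin near_end -> t p = p) (t \in end_perm).
Proof.
rewrite !inE; apply: (iffP andP) => -[ot tP]; split=> //.
  by move=> p /negPf pe; have /forallP/(_ p) := tP; rewrite pe => /eqP.
apply/forallP => p; case: (boolP (p \in near_end)) => //= pe.
by rewrite tP.
Qed.

Lemma end_permV (t : {perm P}) : t \in end_perm -> (t^-1)%g \in end_perm.
Proof.
case/end_permP=> ot tP; apply/end_permP; split; first by rewrite odd_permV.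
by move=> p pe; apply: (@perm_inj _ t); rewrite permKV tP.
Qed.

Inductive letter := LQ of qletter | LT of {perm P} | LE of A.

Definition valid (l : letter) : bool :=
  match l with LQ _ => true | LT t => t \in end_perm | LE r => r \in S end.

Let k0 := (false, false).
Let k1 := (true, false).

Definition letter_mx (l : letter) : 'M[A]_m :=
  match l with
  | LQ c => pmx A g (qperm c)
  | LT t => pmx A g t
  | LE r => elem_mx g (zone, k0) (zone, k1) r
  end.

Definition letters : 'M[A]_m -> Prop :=
  mclos (fun M => exists2 l, valid l & M = letter_mx l).

Lemma letters_valid l : valid l -> letters (letter_mx l).
Proof. by move=> vl; apply: mclos_in; exists l. Qed.

Lemma letter_elem_prod l : valid l -> elem_prod g (letter_mx l).
Proof.
case: l => [c|t|r] /=.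
- by move=> _; apply: (even_perm_elem A gK hK); exact: even_qperm.
- by case/end_permP => ot _; exact: (even_perm_elem A gK hK).
- by move=> _; apply: elem_mx_prod; rewrite xpair_eqE eqxx.
Qed.

(** * All elementary matrices from the letters *)

Local Notation e := (elem_mx g).

Lemma letters_conj (s : {perm P}) p p' r :
  letters (pmx A g s) -> letters (pmx A g s^-1%g) ->
  letters (e (s p) (s p') r) -> letters (e p p' r).
Proof.
move=> ls lV le; rewrite -[e p p' r]mulr1 -(pmx1 A gK) -(mulgV s) (pmxM A gK hK).
by rewrite mulrA -(pmx_elem gK hK); apply: mclos_mul => //; exact: mclos_mul.
Qed.

Lemma letters_qconj c p p' r :
  letters (e (pact c p) (pact c p') r) -> letters (e p p' r).
Proof.
rewrite -!qpermE; apply: letters_conj; rewrite ?qpermV;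
  exact: (@letters_valid (LQ c)).
Qed.

Lemma letters_qconjE c p p' r :
  letters (e p p' r) -> letters (e (pact c p) (pact c p') r).
Proof. by move=> H; apply: (@letters_qconj c); rewrite !pactK. Qed.

Lemma end_fresh (l : seq P) : (size l <= 3)%N ->
  exists2 p, p \in near_end & p \notin l.
Proof.
move=> l3; pose u : seq P := [seq (zend, k) | k <- enum {: bool * bool}].
have [/allP ul|/allPn[p pu pl]] := boolP (all [in l] u).
  have : (size u <= size l)%N.
    apply: uniq_leq_size; last exact: ul.
    by rewrite map_inj_uniq ?enum_uniq // => a b [].
  by rewrite size_map -cardE card_prod card_bool leqNgt (leq_ltn_trans l3).
by exists p => //; case/mapP: pu => k _ ->; rewrite inE /= eqxx.
Qed.

Definition three_cycle (i j k : P) : {perm P} := (tperm i j * tperm j k)%g.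

Lemma three_cycle_end i j k : i != j -> j != k ->
  i \in near_end -> j \in near_end -> k \in near_end -> three_cycle i j k \in end_perm.
Proof.
move=> ij jk ie je ke; apply/end_permP; split.
  by rewrite odd_permM !odd_tperm ij jk.
move=> p pe; have ne x : x \in near_end -> x != p by apply: contraTneq => ->.
by rewrite permM !tpermD ?ne.
Qed.

Lemma letters_end_conj t p p' r : t \in end_perm ->
  letters (e (t p) (t p') r) -> letters (e p p' r).
Proof.
move=> te; apply: letters_conj; first exact: (@letters_valid (LT t)).
by apply: (@letters_valid (LT t^-1%g)); exact: end_permV.
Qed.

(** Conjugate by the 3-cycle through a fresh [k] that sends [j] to [j'] and fixes [i]; the
    transposition of [j] and [j'] would be odd. *)
Lemma letters_move_r i j j' r : i \in near_end -> j \in near_end -> j' \in near_end ->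
  i != j -> i != j' -> letters (e i j' r) -> letters (e i j r).
Proof.
move=> ie je je' ij ij'; have [->//|jj'] := eqVneq j j'.
have [k ke] := @end_fresh [:: i; j; j'] isT.
rewrite !inE !negb_or => /and3P[ki kj kj'].
have te : three_cycle j k j' \in end_perm by apply: three_cycle_end; rewrite // eq_sym.
move=> H; apply: (letters_end_conj te).
rewrite !permM tpermL tpermL !(tpermD (z := i)) //.
- by rewrite eq_sym.
- by rewrite eq_sym.
Qed.

Lemma letters_move_l i i' j r : i \in near_end -> i' \in near_end -> j \in near_end ->
  i != j -> i' != j -> letters (e i' j r) -> letters (e i j r).
Proof.
move=> ie ie' je ij ij'; have [->//|ii'] := eqVneq i i'.
have [k ke] := @end_fresh [:: i; i'; j] isT.
rewrite !inE !negb_or => /and3P[ki kj kj'].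
have te : three_cycle i k i' \in end_perm by apply: three_cycle_end; rewrite // eq_sym.
move=> H; apply: (letters_end_conj te).
by rewrite !permM tpermL tpermL !(tpermD (z := j)).
Qed.

Lemma letters_move i j i' j' r :
  i \in near_end -> j \in near_end -> i' \in near_end -> j' \in near_end ->
  i != j -> i' != j' -> letters (e i' j' r) -> letters (e i j r).
Proof.
move=> ie je ie' je' ij ij' H; have [i'j|i'j] := eqVneq i' j; last first.
  by apply: (@letters_move_l _ i') => //; exact: (@letters_move_r _ _ j').
(* Here the index pairs collide, so the move detours through a fresh [k]: from (j, j') to (j, k),
   (i, k) and (i, j). *)
move: ij' H; rewrite i'j => jj' H.
have [k ke] := @end_fresh [:: i; j] isT.
rewrite !inE !negb_or => /andP[ki kj]; rewrite eq_sym in ki; rewrite eq_sym in kj.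
apply: (@letters_move_r _ _ k) => //; apply: (@letters_move_l _ j) => //.
exact: (@letters_move_r _ _ j').
Qed.

Lemma letters_orbit w p p' r :
  letters (e (foldr pact p w) (foldr pact p' w) r) -> letters (e p p' r).
Proof. by elim: w => //= c w IH /letters_qconj. Qed.

Lemma foldr_pact w z k : foldr pact (z, k) w = (foldr zact z w, k).
Proof. by elim: w => //= c w ->. Qed.

Lemma zact_transitive z : exists w, foldr zact z w = zone.
Proof.
have [w wE] := qact_transitive z; exists w; apply/val_inj.
rewrite size_tuple in wE; apply: etrans wE.
by elim: w => //= c w ->.
Qed.

(** The tree group carries [zend] to [zone] within each copy, so the generator at [zone] is
    conjugate to one at [zend], which [letters_move] spreads over all pairs near the end. *)
Lemma letters_end_gen i j r : i \in near_end -> j \in near_end -> i != j ->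
  r \in S -> letters (e i j r).
Proof.
move=> ie je ij rS.
have ke k : (zend, k) \in near_end by rewrite inE /= eqxx.
have kk : (zend, k0) != (zend, k1) :> P by rewrite xpair_eqE eqxx.
apply: (letters_move ie je (ke k0) (ke k1) ij kk).
have [w wE] := zact_transitive zend.
apply: (@letters_orbit w); rewrite !foldr_pact wE.
exact: (@letters_valid (LE r)).
Qed.

Lemma letters_end i j r : i \in near_end -> j \in near_end -> i != j ->
  letters (e i j r).
Proof.
move=> ie je ij.
(* [B] is shown to be a subring containing [S]: sums come from products of matrices, ring products
   from commutators through a third point. Both signs are carried along for differences and
   commutators. *)
pose B : set A := [set r | forall i j, i \in near_end -> j \in near_end -> i != j ->
  letters (e i j r) /\ letters (e i j (- r))].
have BS : B = setT.
  apply/seteqP; split=> // x _; have : [set: A] x by [].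
  rewrite -S_gen; apply; split=> [|{}r rS a b ae be ab]; last first.
    by split; apply: letters_end_gen => //; exact: S_opp.
  split=> [|r1 r2|r1 r2]; rewrite !inE /B /=.
  - by move=> a b ae be ab; split; apply: letters_end_gen => //; exact: S_opp.
  - move=> H1 H2 a b ae be ab; have [p1 n1] := H1 a b ae be ab.
    have [p2 n2] := H2 a b ae be ab.
    rewrite opprB (addrC r2) -!(elem_mxD gK hK) //.
    by split; exact: mclos_mul.
  move=> H1 H2 a b ae be ab.
  have [c ce] := @end_fresh [:: a; b] isT.
  rewrite !inE !negb_or => /andP[ca cb]; have ac : a != c by rewrite eq_sym.
  have [p1 n1] := H1 a c ae ce ac; have [p2 n2] := H2 c b ce be cb.
  rewrite -mulNr -!(@elem_mx_comm _ _ _ _ _ gK hK a c b) // opprK.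
  by split; do !apply: mclos_mul.
by have : B r by [rewrite BS]; move=> /(_ i j ie je ij) [].
Qed.

Let full p p' := p != p' -> forall r, letters (e p p' r).

Let full_trans p1 p2 p3 : full p1 p2 -> full p2 p3 -> full p1 p3.
Proof.
have [->|p12] := eqVneq p1 p2; first by [].
have [->|p23] := eqVneq p2 p3; first by [].
move=> H1 H2 p13 r; rewrite -[r]mulr1 -(@elem_mx_comm _ _ _ _ _ gK hK p1 p2 p3) //.
by do !apply: mclos_mul; [exact: H1 | exact: H2 | exact: H1 | exact: H2].
Qed.

Let full_pact c p p' : full p p' -> full (pact c p) (pact c p').
Proof.
by rewrite /full (inj_eq (inv_inj (pactK c))) => H pp' r; exact/letters_qconjE/H.
Qed.

(** Every tree letter keeps [p0] near the end, so the set [B] of points linked with [p0] in both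
    directions is invariant under the tree group. It contains points of all four copies, and the
    group is transitive on each copy. *)
Theorem letters_elem p p' r : p != p' -> letters (e p p' r).
Proof.
pose p0 : P := (zend, k0); pose B p := full p p0 /\ full p0 p.
have p0e : p0 \in near_end by rewrite inE /= eqxx.
have Bend p1 : p1 \in near_end -> B p1.
  by move=> pe; split=> p10 r1; exact: letters_end.
have Bp0 c : B (pact c p0).
  apply: Bend; rewrite inE /=; case: c => [x|]; last by rewrite eqxx orbT.
  suff -> : zact (Some x) zend = zend by rewrite eqxx.
  by apply/val_inj; exact: kfixed_nseq_false.
have Bact c p1 : B p1 -> B (pact c p1).
  move=> [H1 H2]; have [H3 H4] := Bp0 c.
  by split; [apply: full_trans H3 | apply: (full_trans H4)]; exact: full_pact.
have Bfold w p1 : B p1 -> B (foldr pact p1 w) by move=> ?; elim: w => //= c w; exact: Bact.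
have Bunfold w p1 : B (foldr pact p1 w) -> B p1.
  by elim: w => //= c w IH /(Bact c); rewrite pactK => /IH.
have Ball p1 : B p1.
  case: p1 => z k; have [w wE] := zact_transitive z; have [w' wE'] := zact_transitive zend.
  apply: (Bunfold w); rewrite foldr_pact wE -wE' -foldr_pact.
  by apply: Bfold; apply: Bend; rewrite inE /= eqxx.
move=> pp'; have [H _] := Ball p; have [_ H'] := Ball p'.
exact: (full_trans H H').
Qed.

Lemma letter_mxV l : valid l ->
  exists2 l', valid l' & letter_mx l * letter_mx l' = 1.
Proof.
case: l => [c|t|r] /= vl.
- exists (LQ c) => //=; rewrite -(pmxM A gK hK) -{2}qpermV mulgV; exact: (pmx1 A gK).
- exists (LT t^-1%g) => /=; first exact: end_permV.
  rewrite -(pmxM A gK hK) mulgV; exact: (pmx1 A gK).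
exists (LE (- r)); first exact: S_opp.
by rewrite /= (elem_mxD gK hK) ?subrr ?elem_mx0 // xpair_eqE eqxx.
Qed.

Definition letter_seq : seq 'M[A]_m :=
  [seq letter_mx (LQ c) | c <- enum {: option (bool * bool)}] ++
  [seq letter_mx (LT t) | t <- enum end_perm] ++ [seq letter_mx (LE r) | r <- S].

Lemma letter_seqP M : M \in letter_seq <-> exists2 l, valid l & M = letter_mx l.
Proof.
rewrite !mem_cat; split.
  case/or3P => /mapP[x xin ->]; first by exists (LQ x).
    by exists (LT x) => //=; rewrite mem_enum in xin.
  by exists (LE x).
case=> -[c|t|r] /= vl ->; apply/or3P.
- by apply: Or31; apply: (map_f (fun c => letter_mx (LQ c))); rewrite mem_enum.
- by apply: Or32; apply: (map_f (fun t => letter_mx (LT t))); rewrite mem_enum.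
- by apply: Or33; apply: (map_f (fun r => letter_mx (LE r))).
Qed.

(** The second clause turns words over the generators and their inverses into words of valid letters
    of the same length. *)
Lemma generating_fset : exists X : {fset EL A m},
  generated [set` X] = setT /\
  forall x : EL A m, (x \in X) || (x^-1%g \in X) ->
    exists2 l, valid l & GL_val (subgroup_gen_val x) = letter_mx l.
Proof.
pose v (x : EL A m) : 'M[A]_m := GL_val (subgroup_gen_val x).
have v_inj x y : v x = v y -> x = y by move=> E; do 2!apply/val_inj.
have vM x y : v (x * y)%g = v x * v y by [].
have v1 : v 1%g = 1 by [].
(* The default [1%g] is never taken on valid letters, since their matrices lie in [EL]. *)
pose f (M : 'M[A]_m) : EL A m := xget 1%g [set x | v x = M].
have fE l : valid l -> v (f (letter_mx l)) = letter_mx l.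
  move=> vl; have [x xM] := elem_prod_EL gK hK (letter_elem_prod vl).
  by rewrite /f; case: xgetP => [y -> //|/(_ x)].
pose X : {fset EL A m} := [fset f M | M in letter_seq]%fset.
have Xl x : x \in X -> exists2 l, valid l & v x = letter_mx l.
  by case/imfsetP => _ /= /letter_seqP[l vl ->] ->; exists l => //; exact: fE.
exists X; split; last first.
  move=> x /orP[/Xl //|/Xl[l vl xl]]; have [l' vl' ll'] := letter_mxV vl.
  exists l' => //; rewrite -/(v x) -[v x]mulr1 -ll' -xl mulrA -vM mulgV.
  by rewrite v1 mul1r.
have genM M : letters M -> exists2 x, x \in generated [set` X] & v x = M.
  have [G1 GV] := generated_group_closed [set` X].
  elim=> [|_ M' [l vl ->] _ [y yG yM]]; first by exists 1%g.
  have lG : f (letter_mx l) \in generated [set` X].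
    rewrite inE => H /= [_]; apply; apply/imfsetP; exists (letter_mx l) => //=.
    by apply/letter_seqP; exists l.
  exists (f (letter_mx l) * y)%g; last by rewrite vM fE // yM.
  have yV : y^-1%g \in generated [set` X] by rewrite -[y^-1%g]mul1g; exact: GV.
  by rewrite -[y]invgK; exact: GV.
apply/seteqP; split=> // x _.
pose K : set (GL A m) := [set y | exists2 x : EL A m, x \in generated [set` X] &
   subgroup_gen_val x = y].
have : K (subgroup_gen_val x).
  have := subgroup_gen_valP x; rewrite inE; apply; split.
    have [G1 GV] := generated_group_closed [set` X].
    split; first by rewrite inE; exists 1%g.
    move=> a b; rewrite !inE => -[a' aG <-] [b' bG <-].
    by exists (a' / b')%g; first exact: GV.
  move=> y [i [j [r [ij yE]]]].
  have : letters (e (g i) (g j) r) by apply: letters_elem; rewrite (inj_eq (can_inj gK)).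
  case/genM=> x' x'G x'E; exists x' => //; apply/val_inj; rewrite /= yE -/(v x') x'E.
  congr (_ + _); apply/matrixP => a b; rewrite !mxE !(inj_eq (can_inj gK)).
  by case: (_ && _); rewrite ?mulr1 ?mulr0.
case=> x' x'G /val_inj xx'; by rewrite -xx'; rewrite inE in x'G.
Qed.

(** * Normal form of short words *)

Definition word_mx (w : seq letter) : 'M[A]_m := \prod_(l <- w) letter_mx l.

(* [aa] records the position of a letter outside the tree group, and makes
   both ends of the [a]-edge at [zend] images of [zend] under prefixes. *)
Definition letter_q (l : letter) : seq qletter :=
  if l is LQ c then [:: c] else [:: None; None].
Definition word_q (w : seq letter) : seq qletter := flatten (map letter_q w).

Lemma size_word_q w : (size (word_q w) <= 2 * size w)%N.
Proof. by elim: w => //= -[c|t|r] w IH; rewrite /word_q /= -/(word_q w); lia. Qed.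

Definition qprod (w : seq qletter) : {perm P} := (\prod_(c <- w) qperm c)%g.

Lemma qprodV w p : (qprod w)^-1%g p = foldr pact p w.
Proof.
elim: w p => [|c w IH] p; first by rewrite /qprod big_nil invg1 perm1.
by rewrite /qprod big_cons invgM permM -/(qprod w) IH qpermV qpermE.
Qed.

Lemma qprod_aa w : qprod [:: None, None & w] = qprod w.
Proof. by rewrite /qprod !big_cons mulgA -{1}(qpermV None) mulVg mul1g. Qed.

(** The product over [z] of the elementary matrices with entry [f z] from copy [k0] to copy [k1].
    They commute, as products of such entries vanish. *)
Definition shear (f : Z -> A) : 'M[A]_m := 1 + mxf g (fun p p' =>
  if (p.2 == k0) && (p' == (p.1, k1)) then f p.1 else 0).

Lemma shearD f f' : shear f * shear f' = shear (fun z => f z + f' z).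
Proof.
rewrite /shear mulrDl mul1r mulrDr mulr1 (mxfM gK hK).
rewrite (_ : mxf g (fun p q => \sum_x _) = 0); last first.
  rewrite (mxf0 A g); apply: eq_mxf => p q; apply: big1 => x _.
  case: ifP => [/andP[_ /eqP->]|]; last by rewrite mul0r.
  by rewrite mulr0.
rewrite addr0 -addrA mxfD; congr (1 + _).
by apply: eq_mxf => p q; case: ifP => _; rewrite ?addr0 // addrC.
Qed.

Lemma eq_shear f f' : f =1 f' -> shear f = shear f'.
Proof. by move=> ff'; rewrite /shear; congr (1 + _); apply: eq_mxf => p q; rewrite ff'. Qed.

Lemma shear0 : shear (fun=> 0) = 1.
Proof.
rewrite /shear -[RHS]addr0; congr (1 + _); rewrite (mxf0 A g).
by apply: eq_mxf => p q; rewrite if_same.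
Qed.

Lemma shear_letter r : letter_mx (LE r) = shear (fun z => if z == zone then r else 0).
Proof.
rewrite /= /elem_mx /shear; congr (1 + _); apply: eq_mxf => -[z k] [z' k'] /=.
rewrite !xpair_eqE; case: (eqVneq z zone) => [->|] /=; first by [].
by rewrite if_same.
Qed.

Lemma qperm_shear c f :
  pmx A g (qperm c) * shear f = shear (f \o zact c) * pmx A g (qperm c).
Proof.
rewrite /shear mulrDr mulrDl mulr1 mul1r (pmx_mxf gK hK) (mxf_pmx gK hK).
congr (_ + _); apply: eq_mxf => -[z k] [z' k']; rewrite qpermV !qpermE /pact /=.
by rewrite !xpair_eqE (can2_eq (zactK c) (zactK c)).
Qed.

Lemma pmx_shear (t : {perm P}) f : (forall z k, f z != 0 -> t (z, k) = (z, k)) ->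
  pmx A g t * shear f = shear f * pmx A g t.
Proof.
move=> tf; rewrite /shear mulrDr mulrDl mulr1 mul1r (pmx_mxf gK hK) (mxf_pmx gK hK).
congr (_ + _); apply: eq_mxf => -[z k] p' /=.
have [fz|/(tf z) tz] := eqVneq (f z) 0; last first.
  rewrite tz /=; have -> // : (t^-1%g p' == (z, k1)) = (p' == (z, k1)).
  by rewrite -(inj_eq (@perm_inj _ t)) permKV tz.
(* Were [f] nonzero below the image of (z, k), [t] would fix that image, hence fix (z, k) by
   injectivity, contradicting [f z = 0]. *)
rewrite fz if_same; case: ifP => // _; apply/eqP/contraT => ftz.
have := tf _ (t (z, k)).2 ftz; rewrite -surjective_pairing => /perm_inj tt.
by rewrite tt /= fz eqxx in ftz.
Qed.

(** Coefficients are recorded as multiplicities of ring generators, which are bounded by the length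
    of the word. *)
Definition count_val (cnt : Z -> 'I_(size S) -> nat) (z : Z) : A :=
  \sum_(i < size S) (S`_i) *+ cnt z i.

Definition prefix_image (w : seq qletter) (z0 z : Z) : Prop :=
  exists w1 w2, w = w1 ++ w2 /\ z = foldr zact z0 w1.

Lemma prefix_image0 w z0 : prefix_image w z0 z0.
Proof. by exists [::], w. Qed.

Lemma prefix_image_cons c w z0 z :
  prefix_image w z0 (zact c z) -> prefix_image (c :: w) z0 z.
Proof.
by case=> w1 [w2 [-> E]]; exists (c :: w1), w2; rewrite /= -E zactK.
Qed.

Lemma prefix_image_aa w z0 z :
  prefix_image w z0 z -> prefix_image [:: None, None & w] z0 z.
Proof. by move=> H; do 2!apply: prefix_image_cons; rewrite zactK. Qed.

Lemma val_foldr_zact (z : Z) w : val (foldr zact z w) = qact w (val z).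
Proof. by elim: w => //= c w ->. Qed.

Lemma gpos_near_end p : p \in near_end -> (2 ^ N.+1 - 2 <= gpos (val p.1))%N.
Proof.
have E : gpos (val zend) = (2 ^ N.+1).-1 by exact: gpos_nseq_false.
rewrite inE => /orP[/eqP->|/eqP->]; first by rewrite E; lia.
have [_ H] := gpos_qact1 None (val zend); rewrite E in H; set x := gpos _.
have : ((2 ^ N.+1).-1 <= x.+1)%N by exact: H.
lia.
Qed.

Lemma gpos_prefix_zone w z : prefix_image w zone z -> (gpos (val z) <= size w)%N.
Proof.
case=> w1 [w2 [-> ->]]; rewrite val_foldr_zact size_cat.
have [H _] := gpos_qact w1 (val zone); have E : gpos (val zone) = 0%N by exact: gpos_nseq.
by rewrite E in H; lia.
Qed.

(** Induction on the word. A new tree letter conjugates both local factors, an end permutation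
    passes the shear and joins [t], and an elementary letter raises one multiplicity at [zone]. *)
Lemma word_form w : all valid w -> (size (word_q w) + 2 < 2 ^ N.+1)%N ->
  exists (cnt : Z -> 'I_(size S) -> nat) (t : {perm P}),
  [/\ word_mx w = shear (count_val cnt) * pmx A g t * pmx A g (qprod (word_q w)),
      forall z i, (cnt z i <= size w)%N,
      forall z i, cnt z i <> 0%N -> prefix_image (word_q w) zone z &
      forall p, t p <> p -> prefix_image (word_q w) zend p.1].
Proof.
elim: w => [|l w IH] /= => [_ _|/andP[vl vw] sz].
  exists (fun _ _ => 0%N), 1%g; split=> // [|p]; last by rewrite perm1.
  rewrite /word_mx big_nil /qprod big_nil !(pmx1 A gK) !mulr1 -shear0.
  by apply: eq_shear => z; rewrite /count_val big1 // => i _; rewrite mulr0n.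
have {IH} [|cnt [t [E cle cs ts]]] := IH vw.
  by move: sz; rewrite /word_q /= size_cat; lia.
have wE : word_mx (l :: w) = letter_mx l * word_mx w by rewrite /word_mx big_cons.
case: l vl sz wE => [c|s|r] vl sz wE.
- exists (cnt \o zact c), (qperm c * t * (qperm c)^-1)%g; split.
  + rewrite wE E /= /word_q /= -/(word_q w) /qprod big_cons -/(qprod _).
    rewrite !(pmxM A gK hK) !mulrA qperm_shear; congr (_ * _).
    by rewrite -(mulrA _ (pmx A g (qperm c)^-1%g)) -(pmxM A gK hK) mulVg (pmx1 A gK) mulr1.
  + by move=> z i; exact: leq_trans (cle _ _) _.
  + by move=> z i /cs; exact: prefix_image_cons.
  move=> p H; apply: prefix_image_cons.
  have : t (qperm c p) <> qperm c p.
    by apply: contra_not H => H; rewrite !permM H permK.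
  by move/ts; rewrite qpermE.
- exists cnt, (s * t)%g; split => //.
  + rewrite wE E /word_q /= -/(word_q w) qprod_aa (pmxM A gK hK) !mulrA.
    rewrite pmx_shear //= => z k cz; case/end_permP: vl => _; apply.
    (* The shear is supported at positions at most [size (word_q w)], the points near the end lie at
       positions at least 2^(N+1) - 2. *)
    apply/negP => /gpos_near_end /=.
    have [i] : exists i, cnt z i <> 0%N.
      apply/existsNP => H; move/eqP: cz; apply; rewrite /count_val big1 // => i _.
      by rewrite H mulr0n.
    move=> /cs /gpos_prefix_zone; move: sz; rewrite /word_q /= -/(word_q w); lia.
  + by move=> z i; exact: leq_trans (cle _ _) _.
  + by move=> z i /cs; exact: prefix_image_aa.
  move=> p; rewrite permM; have [H|H] := boolP (p \in near_end).
    move=> _; move: H; rewrite inE /= => /orP[/eqP->|/eqP->].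
      exact: prefix_image0.
    by apply: prefix_image_cons; rewrite zactK; exact: prefix_image0.
  case/end_permP: vl => _ /(_ _ H) -> /ts; exact: prefix_image_aa.
have vr : r \in S by [].
pose ir : 'I_(size S) := Ordinal (eq_ind_r is_true vr (index_mem r S)).
exists (fun z i => cnt z i + ((z == zone) && (i == ir)))%N, t; split.
- rewrite wE E /word_q /= -/(word_q w) qprod_aa !mulrA -[elem_mx _ _ _ _]/(letter_mx (LE r)).
  rewrite shear_letter shearD; congr (_ * _ * _); apply: eq_shear => z.
  rewrite /count_val addrC.
  under [in RHS]eq_bigr do rewrite mulrnDr.
  rewrite big_split /=; congr (_ + _); rewrite (bigD1 ir) //= eqxx andbT.
  rewrite big1 ?addr0 => [|i /negPf->]; last by rewrite andbF mulr0n.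
  by rewrite nth_index //; case: (z == zone).
- by move=> z i; have := cle z i; case: (_ && _); rewrite /=; lia.
- move=> z i; case: (eqVneq z zone) => [->|zz] /=; first by move=> _; exact: prefix_image0.
  by rewrite addn0 => /cs; exact: prefix_image_aa.
by move=> p /ts; exact: prefix_image_aa.
Qed.

(** * Codes for words of length at most [l] *)

Section Counting.
Variables (k B l : nat).
Hypothesis kN : (k <= N)%N.
Hypothesis lN : (2 * l + 2 < 2 ^ N.+1)%N.
Hypothesis tailB : forall w : seq qletter, (size w <= 2 * l)%N ->
  (tail_total k (qnorm w) <= B)%N.

Lemma prefix_image_cover w z0 p z : val z0 = nseq k true ++ p -> kfixed (val z0) ->
  prefix_image w z0 z -> val z \in norb_cover k (qnorm w) p.
Proof.
move=> z0E fz [w1 [w2 [-> ->]]]; rewrite val_foldr_zact; apply: norb_coverP.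
  by rewrite -z0E.
by rewrite -z0E; exact: qact_prefix_norb.
Qed.

(** [insub] drops strings of wrong length; prefix images have length [N.+1] and survive. *)
Definition orbit_cover (w : seq letter) (p : seq bool) : seq Z :=
  pmap insub (norb_cover k (qnorm (word_q w)) p).

Lemma size_orbit_cover w p : (size w <= l)%N -> (size (orbit_cover w p) <= 2 ^ k + B)%N.
Proof.
move=> wl; rewrite size_pmap_sub; apply: leq_trans (count_size _ _) _.
rewrite size_norb_cover leq_add2l; apply: tailB.
by apply: leq_trans (size_word_q w) _; rewrite leq_mul2l.
Qed.

(** The two strings are what remains of [zone] and [zend] after removing [k] leading ones. *)
Definition support_cover w : seq Z :=
  orbit_cover w (nseq (N.+1 - k) true) ++
  orbit_cover w (nseq (N - k) true ++ [:: false]).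

Lemma mem_support_cover w z : prefix_image (word_q w) zone z \/
  prefix_image (word_q w) zend z -> z \in support_cover w.
Proof.
rewrite mem_cat; case=> H; apply/orP; [left|right]; rewrite mem_pmap_sub.
  apply: prefix_image_cover H; last exact: kfixed_nseq.
  by rewrite -nseqD subnKC // (leq_trans kN).
apply: prefix_image_cover H; last exact: kfixed_nseq_false.
by rewrite catA -nseqD subnKC.
Qed.

Definition local_data : finType :=
  ({ffun 'I_(size S) -> 'I_l.+1} * {ffun bool * bool -> P})%type.

Definition local_id (z : Z) : local_data := ([ffun=> ord0], [ffun b => (z, b)]).

Definition local_of (cnt : Z -> 'I_(size S) -> nat) (t : {perm P}) (z : Z) : local_data :=
  ([ffun i => inord (cnt z i)], [ffun b => t (z, b)]).

Definition word_code : finType :=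
  (leaf_code k B * (2 * (2 ^ k + B)).-tuple (Z * local_data))%type.

Definition is_word_code (d : word_code) (M : 'M[A]_m) : Prop :=
  exists w cnt (t : {perm P}),
  [/\ all valid w /\ (size w <= l)%N,
      M = shear (count_val cnt) * pmx A g t * pmx A g (qprod (word_q w)),
      forall z i, (cnt z i <= l)%N,
      forall z, z \notin support_cover w -> local_of cnt t z = local_id z &
      d = (nform_code k B (qnorm (word_q w)),
           sparse_code zone (2 * (2 ^ k + B)) (support_cover w) (local_of cnt t))].

Lemma word_has_code w : all valid w -> (size w <= l)%N ->
  exists d, is_word_code d (word_mx w).
Proof.
move=> vw wl; have szw := size_word_q w.
have [|cnt [t [E cle cs ts]]] := word_form vw; first by move: lN; lia.
exists (nform_code k B (qnorm (word_q w)),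
        sparse_code zone (2 * (2 ^ k + B)) (support_cover w) (local_of cnt t)).
exists w, cnt, t; split=> //; first by move=> z i; exact: leq_trans (cle z i) wl.
move=> z zw; rewrite /local_of /local_id; congr pair; apply/ffunP => x; rewrite !ffunE.
  suff -> : cnt z x = 0%N by apply/val_inj; rewrite /= inordK.
  have [//|/eqP nz] := eqVneq (cnt z x) 0%N.
  by case/negP: zw; apply: mem_support_cover; left; exact: cs nz.
have [//|/eqP nz] := eqVneq (t (z, x)) (z, x).
by case/negP: zw; apply: mem_support_cover; right; exact: ts nz.
Qed.

(** The leaf code determines the tree action and the sparse code determines [t] and the
    multiplicities, so all three factors agree. *)
Lemma word_code_inj d M M' : is_word_code d M -> is_word_code d M' -> M = M'.
Proof.
case=> w [cnt [t [[vw wl] -> cl sc dE]]] [w' [cnt' [t' [[vw' wl'] -> cl' sc' dE']]]].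
have dd : (nform_code k B (qnorm (word_q w)),
           sparse_code zone (2 * (2 ^ k + B)) (support_cover w) (local_of cnt t)) =
          (nform_code k B (qnorm (word_q w')),
           sparse_code zone (2 * (2 ^ k + B)) (support_cover w') (local_of cnt' t')).
  by rewrite -dE dE'.
have size_cover u : (size u <= l)%N -> (size (support_cover u) <= 2 * (2 ^ k + B))%N.
  by move=> ul; rewrite size_cat mul2n -addnn leq_add // size_orbit_cover.
have qB u : (size u <= l)%N -> (tail_total k (qnorm (word_q u)) <= B)%N.
  by move=> ul; apply: tailB; apply: leq_trans (size_word_q u) _; rewrite leq_mul2l.
have lE := sparse_code_inj (size_cover _ wl) (size_cover _ wl') sc sc'
  (congr1 (fun x : word_code => x.2) dd).
have nE := nform_code_inj (qB _ wl) (qB _ wl') (congr1 (fun x : word_code => x.1) dd).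
have -> : qprod (word_q w) = qprod (word_q w').
  apply: invg_inj; apply/permP => -[z b]; rewrite !qprodV !foldr_pact; congr pair.
  by apply/val_inj; rewrite !val_foldr_zact -!nact_qnorm nE.
have -> : t = t'.
  apply/permP => -[z b]; have /(congr1 (fun x : local_data => x.2 b)) := lE z.
  by rewrite !ffunE.
congr (_ * _ * _); apply: eq_shear => z; apply: eq_bigr => i _; congr (_ *+ _).
have /(congr1 (fun x : local_data => val (x.1 i))) := lE z.
by rewrite !ffunE /= !inordK // ltnS.
Qed.

Lemma card_word_code : #|word_code| =
  (2 ^ 2 ^ k * 4 ^ 2 ^ k * B.+1 ^ 2 ^ k * 4 ^ B *
   (2 ^ N.+1 * (l.+1 ^ size S * (2 ^ N.+1 * 4) ^ 4)) ^ (2 * (2 ^ k + B)))%N.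
Proof.
rewrite card_prod card_leaf_code card_tuple !card_prod !card_ffun !card_prod.
by rewrite !card_tuple !card_bool !card_ord.
Qed.

Lemma growth_le_card (X : {fset EL A m}) :
  (forall x : EL A m, (x \in X) || (x^-1%g \in X) ->
    exists2 l, valid l & GL_val (subgroup_gen_val x) = letter_mx l) ->
  (growth X l <= #|word_code|)%N.
Proof.
move=> Xl; pose v (x : EL A m) : 'M[A]_m := GL_val (subgroup_gen_val x).
have v_inj x y : v x = v y -> x = y by move=> E; do 2!apply/val_inj.
apply: (@card_fset_set_le _ _ _ (fun d x => is_word_code d (v x))).
- exact: finite_word_ball.
- move=> _ [u [ul aX ->]].
  suff [w [vw sw ->]] : exists w, [/\ all valid w, size w = size u &
      v (\prod_(a <- u) a)%g = word_mx w].
    by apply: word_has_code; rewrite ?sw.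
  elim: u aX {ul} => [_|a u IH /= /andP[/Xl[b vb ab] /IH[w [vw sw E]]]].
    by exists [::]; rewrite /word_mx !big_nil.
  exists (b :: w); split; rewrite /= ?vb ?sw //.
  by rewrite /word_mx !big_cons -/(word_mx w) -E -ab.
by move=> d x y dx dy; apply: v_inj; exact: word_code_inj dx dy.
Qed.

End Counting.

End Construction.

(** * Asymptotics *)

Section Eta.
Variable R : realType.

Lemma etaE : eta R ^+ 3 + eta R ^+ 2 + eta R = 2.
Proof.
have [x [rx _]] := eta_poly_root_unique R.
have : root (eta_poly R) (eta R) by rewrite /eta; case: xgetP => [y _ //|/(_ x)].
by rewrite rootE /eta_poly !hornerE => /eqP; lra.
Qed.

Lemma eta_gt0 : 0 < eta R.
Proof. have := etaE; have := sqr_ge0 (eta R); rewrite ltNge; case: leP => //; nra. Qed.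

Lemma eta_lt1 : eta R < 1.
Proof. have := etaE; rewrite ltNge; case: leP => //; nra. Qed.

Lemma ln2_gt0 : 0 < ln 2 :> R.
Proof. by apply: ln_gt0; lra. Qed.

Lemma ln_2eta_gt : ln 2 < ln (2 / eta R).
Proof.
have e0 := eta_gt0; have e1 := eta_lt1.
rewrite ltr_ln ?posrE ?divr_gt0 //.
by rewrite ltr_pdivlMr //; lra.
Qed.

Lemma alpha0_gt0 : 0 < alpha0 R.
Proof. by apply: divr_gt0; [exact: ln2_gt0 | exact: lt_trans ln2_gt0 ln_2eta_gt]. Qed.

Lemma alpha0_lt1 : alpha0 R < 1.
Proof.
have H := lt_trans ln2_gt0 ln_2eta_gt.
by rewrite /alpha0 ltr_pdivrMr // mul1r ln_2eta_gt.
Qed.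

(** By the definition of [alpha0], 2^x equals (2/eta)^(alpha0 x). *)
Lemma powR2_le_eta (x : R) (k : nat) : alpha0 R * x <= k%:R ->
  2 `^ x <= (2 / eta R) ^+ k.
Proof.
have H := lt_trans ln2_gt0 ln_2eta_gt; have e0 := eta_gt0.
have d0 : 0 < 2 / eta R by rewrite divr_gt0.
move=> xk; rewrite -powR_mulrn ?(ltW d0) //.
have pE (a y : R) : 0 < a -> a `^ y = expR (y * ln a) by move=> a0; rewrite /powR gt_eqF.
rewrite !pE // ler_expR.
by move: xk; rewrite /alpha0 mulrAC ler_pdivrMr // mulrC.
Qed.

End Eta.

Lemma leqS_exp2 c k : ((c * 2 ^ k).+1 <= 2 ^ (c + k))%N.
Proof.
rewrite expnD; apply: (@leq_trans (c.+1 * 2 ^ k)); last by rewrite leq_mul2r ltn_expl ?orbT.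
by rewrite mulSn -add1n leq_add2r expn_gt0.
Qed.

(** With all factors written as powers of 2, the exponent is 2^k times 3 + 3C + n + 2(C+1)(n(s+5) +
    8). *)
Lemma code_size_bound (C k l n s : nat) : (k <= n)%N -> (l.+1 <= 2 ^ n)%N ->
  (2 ^ 2 ^ k * 4 ^ 2 ^ k * (C * 2 ^ k).+1 ^ 2 ^ k * 4 ^ (C * 2 ^ k) *
   (2 ^ n * (l.+1 ^ s * (2 ^ n * 4) ^ 4)) ^ (2 * (2 ^ k + C * 2 ^ k)) <=
   2 ^ (2 ^ k * ((4 + 3 * C + 2 * C.+1 * (s + 8)) * n.+1)))%N.
Proof.
move=> kn ln.
have E4 x : (4 ^ x = 2 ^ (2 * x))%N by rewrite expnM.
have En : (2 ^ n * 4 = 2 ^ (n + 2))%N by rewrite expnD.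
have H1 : ((C * 2 ^ k).+1 ^ 2 ^ k <= 2 ^ ((C + n) * 2 ^ k))%N.
  rewrite expnM leq_exp2r ?expn_gt0 //; apply: leq_trans (leqS_exp2 _ _) _.
  by rewrite leq_exp2l // leq_add2l.
have H2 : ((2 ^ n * (l.+1 ^ s * (2 ^ n * 4) ^ 4)) ^ (2 * (2 ^ k + C * 2 ^ k)) <=
    2 ^ ((n + (n * s + (n + 2) * 4)) * (2 * (2 ^ k + C * 2 ^ k))))%N.
  rewrite [leqRHS]expnM leq_exp2r ?muln_gt0 ?addn_gt0 ?expn_gt0 //.
  rewrite En -(expnM 2 (n + 2)) 2!expnD leq_mul2l expn_eq0 /= leq_mul2r.
  case: s => [|s]; first by rewrite muln0 orbT.
  by rewrite (expnM 2 n) leq_exp2r // ln orbT.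
apply: leq_trans (leq_mul (leq_mul (leq_mul (leqnn _) H1) (leqnn _)) H2) _.
rewrite !E4 -!expnD leq_exp2l //; move: (2 ^ k)%N => K; nia.
Qed.

Section Bound.
Variables (R : realType) (A : pzRingType).

Lemma fg_ring_symmetric : fg_ring A -> exists S : seq A,
  [/\ forall r, r \in S -> - r \in S, 1 \in S &
      smallest (fun B : set A => GRing.subring_closed [in B]) [set` S] = setT].
Proof.
case=> s sE; exists ((1 :: s) ++ map -%R (1 :: s)); split.
- move=> r; rewrite !mem_cat => /orP[rs|/mapP[x xs ->]]; apply/orP.
    by right; exact: map_f.
  by left; rewrite opprK.
- by rewrite mem_head.
apply/seteqP; split=> // x _ B [Bc BS].
have : [set: A] x by []; rewrite -sE; apply; split=> // y ys; apply: BS.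
by apply: (_ : y \in _); rewrite mem_cat inE (_ : y \in s) ?orbT.
Qed.

Lemma index_bijection (P : finType) (m : nat) : #|P| = m ->
  exists (g : 'I_m -> P) (h : P -> 'I_m), cancel g h /\ cancel h g.
Proof.
move=> <-; exists enum_val, enum_rank; split; [exact: enum_valK | exact: enum_rankK].
Qed.

(** The word weighs at most (2/eta)^k, so its level [k] sections weigh at most 2^k plus an error of
    4 * 2^k. Each [a] among them costs at least [awt], whence the constant 5 / awt. *)
Lemma tail_total_bound : exists C : nat, forall (k l : nat) (w : seq qletter),
  (2 * l).+1%:R <= (2 / eta R) ^+ k -> (size w <= 2 * l)%N ->
  (tail_total k (qnorm w) <= C * 2 ^ k)%N.
Proof.
have e0 := eta_gt0 R; have e1 := eta_lt1 R; have eE := etaE R.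
have e01 : 0 < eta R < 1 by rewrite e0 e1.
have w0 : 0 < awt (eta R) by exact: awt_gt0.
have C0 : 0 <= 5 / awt (eta R) by rewrite divr_ge0 // ltW.
exists (Num.truncn (5 / awt (eta R))).+1 => k l w lk wl.
have /andP[_ /ltW CE] := truncn_itv C0; move: (Num.truncn _).+1 CE => C CE.
rewrite -(ler_nat R) natrM natrX.
have ek_gt0 : 0 < eta R ^+ k by exact: exprn_gt0.
have H1 := size_leaves e01 eE k (qnorm w).
have H2 := nwt_leaves e01 eE k (qnorm w).
have H4 : nwt (eta R) (qnorm w) <= (2 / eta R) ^+ k.
  by apply: le_trans (nwt_qnorm e01 eE w) (le_trans _ lk); rewrite ler_nat.
have H5 : eta R ^+ k * nwt (eta R) (qnorm w) <= 2 ^+ k.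
  apply: le_trans (ler_wpM2l (ltW ek_gt0) H4) _.
  by rewrite -exprMn mulrC divfK // gt_eqF.
have H6 : awt (eta R) * (tail_total k (qnorm w))%:R <= 5 * 2 ^+ k.
  rewrite /tail_total; apply: le_trans H1 (le_trans H2 _).
  by move: H5; move: (_ * nwt _ _) (2 ^+ k) => x y xy; lra.
have p0 : 0 <= 2 ^+ k :> R by exact: exprn_ge0.
by apply: le_trans _ (ler_wpM2r p0 CE); rewrite mulrAC ler_pdivlMr // (mulrC _ (awt _)).
Qed.

Lemma depth_and_length (n : nat) : (5 <= n)%N -> exists k l : nat,
  [/\ (k < n)%N, (2 ^ n = 16 * l)%N, (2 * l).+1%:R <= (2 / eta R) ^+ k &
      2 ^+ k <= 2 * 2 `^ (alpha0 R * n%:R) :> R].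
Proof.
case: n => // N n5.
have a0 := alpha0_gt0 R; have a1 := alpha0_lt1 R.
have n2E : N.+1%:R - 2 = (N.+1 - 2)%:R :> R by rewrite natrB // (leq_trans _ n5).
have n2 : 0 <= alpha0 R * (N.+1%:R - 2) by rewrite mulr_ge0 ?(ltW a0) // n2E.
have /andP[k1 k2] := truncn_itv n2.
(* With l = 2^(n-4), 2l + 1 is at most 2^(n-2), and [k] is the first integer above alpha0 (n-2), so
   that (2/eta)^k exceeds 2^(n-2). *)
exists (Num.truncn (alpha0 R * (N.+1%:R - 2))).+1, (2 ^ (N.+1 - 4))%N.
move: (Num.truncn _) k1 k2 => k k1 k2; split.
- rewrite ltnS -(ltr_nat R); apply: le_lt_trans k1 _.
  apply: (@lt_le_trans _ _ (N.+1%:R - 2)).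
    by rewrite gtr_pMl // n2E ltr0n subn_gt0 (leq_trans _ n5).
  by rewrite -natr1; lra.
- by rewrite -(expnD 2 4) subnKC // ltnW.
- apply: le_trans _ (powR2_le_eta (ltW k2)).
  rewrite n2E powR_mulrn // -natrX ler_nat.
  have -> : (N.+1 - 2 = 2 + (N.+1 - 4))%N by clear -n5; lia.
  by rewrite expnD; have : (0 < 2 ^ (N.+1 - 4))%N; [rewrite expn_gt0|clear; lia].
rewrite -powR_mulrn // -{2}(powRr1 (ler0n R 2)) -powRD; last by rewrite pnatr_eq0 implybT.
apply: ler_powR; first by lra.
by rewrite -natr1; lra.
Qed.

Lemma inf_growth_rate_bound : fg_ring A -> exists Q : nat, forall n : nat, (5 <= n)%N ->
  (inf_growth_rate (EL A (2 ^ (n + 2))) R <=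
    (expR (Q%:R * n.+1%:R * 2 `^ ((alpha0 R - 1) * n%:R)))%:E)%E.
Proof.
move=> /fg_ring_symmetric[S [S_opp S_one S_gen]].
have [C tailC] := tail_total_bound.
(* The factor 32 is 16 from l = 2^n / 16 times 2 from the bound on 2^k; [ln 2] is bounded by 1. *)
exists (32 * (4 + 3 * C + 2 * C.+1 * (size S + 8)))%N => n n5.
have [k [l [kn nl lk k2R]]] := depth_and_length n5.
have l_gt0 : (0 < l)%N by move: (expn_gt0 2 n); rewrite nl; case: (l).
case: n n5 kn nl k2R => // N n5 kN nl k2R.
have cardP : #|((N.+1.-tuple bool) * (bool * bool))%type : finType| = (2 ^ (N.+1 + 2))%N.
  by rewrite !card_prod card_tuple !card_bool expnD.
have [g [h [gK hK]]] := index_bijection cardP.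
have [X [Xgen Xl]] := generating_fset gK hK S_opp S_one S_gen.
have lN : (2 * l + 2 < 2 ^ N.+1)%N by rewrite nl; clear -l_gt0; lia.
have tailB w : (size w <= 2 * l)%N -> (tail_total k (qnorm w) <= C * 2 ^ k)%N.
  exact: tailC.
set Q := (4 + _ + _)%N.
have growth_le : (growth X l <= 2 ^ (2 ^ k * (Q * N.+2)))%N.
  apply: leq_trans (growth_le_card gK hK S_one kN lN tailB Xl) _.
  rewrite card_word_code; apply: code_size_bound; first by apply: leqW.
  by rewrite nl; clear -l_gt0; lia.
apply: le_trans (inf_growth_rate_le R Xgen l_gt0) _.
rewrite lee_fin ler_expR ler_pdivrMr ?ltr0n //.
move: Q growth_le {lN tailB Xl Xgen tailC cardP gK hK lk} => Q growth_le.
have ln2_le1 : ln 2 <= 1 :> R.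
  have -> : 2 = 1 + 1 :> R by [].
  by apply: le_ln1Dx; lra.
have lng : ln (growth X l)%:R <= 2 ^+ k * (Q%:R * N.+2%:R) :> R.
  apply: (@le_trans _ _ (ln (2 ^+ (2 ^ k * (Q * N.+2))))).
    rewrite ler_ln ?posrE ?exprn_gt0 // ?ltr0n ?growth_gt0 //.
    by rewrite -natrX ler_nat.
  by rewrite lnXn // -[leLHS]mulr_natl !natrM natrX ler_piMr.
apply: le_trans lng _.
have lR : l%:R = 2 `^ N.+1%:R / 16 :> R.
  by rewrite powR_mulrn // -natrX nl natrM mulrAC divff ?mul1r.
have pE : 2 `^ ((alpha0 R - 1) * N.+1%:R) * 2 `^ N.+1%:R = 2 `^ (alpha0 R * N.+1%:R) :> R.
  rewrite -powRD; last by rewrite pnatr_eq0 implybT.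
  by rewrite mulrBl mul1r subrK.
rewrite lR natrM.
have -> : 32 * Q%:R * N.+2%:R * 2 `^ ((alpha0 R - 1) * N.+1%:R) * (2 `^ N.+1%:R / 16) =
   2 * (2 `^ ((alpha0 R - 1) * N.+1%:R) * 2 `^ N.+1%:R) * (Q%:R * N.+2%:R) :> R.
  by move: (2 `^ N.+1%:R) (2 `^ _) Q%:R N.+2%:R => x y q z; field.
by rewrite pE; apply: ler_wpM2r k2R; rewrite mulr_ge0.
Qed.

End Bound.

(** * Absorbing the linear factor and passing to the limit *)

Lemma quadratic_le_expR (R : realType) (x : R) : 0 <= x -> x ^+ 2 / 2 <= expR x.
Proof. by move=> x0; have := expR_ge1Dxn 1 x0; rewrite /factorial /=; lra. Qed.

Lemma linear_le_quadratic (R : realType) (x c K : R) :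
  0 <= K -> 1 <= x -> 4 * K <= x * c ^+ 2 -> K * (x + 1) <= (c * x) ^+ 2 / 2.
Proof.
move=> K0 x1 Kx; have x0 : 0 <= x by lra.
have H1 : K * (x + 1) <= K * (2 * x) by apply: ler_wpM2l => //; lra.
have H2 := ler_wpM2r x0 Kx; apply: le_trans H1 _.
by rewrite exprMn (expr2 x); lra.
Qed.

Unset Implicit Arguments.

Theorem theorem4 (R : realType) (A : pzRingType) (fgA : fg_ring A) :
  (forall beta : R, 0 < beta < 1 - alpha0 R ->
     \forall n \near \oo,
       (inf_growth_rate (EL A (2 ^ (n + 2))) R
          <= (expR (2 `^ (- (beta * (n + 2)%:R))))%:E)%E) /\
  inf_growth_rate (EL A (2 ^ (n + 2))) R @[n --> \oo] --> 1%:E.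
Proof.
have bound (beta : R) : 0 < beta < 1 - alpha0 R ->
     \forall n \near \oo,
       (inf_growth_rate (EL A (2 ^ (n + 2))) R
          <= (expR (2 `^ (- (beta * (n + 2)%:R))))%:E)%E.
  case/andP=> b0 b1; have [Q QP] := inf_growth_rate_bound R fgA.
  (* The spare exponent [d] gives a factor 2^(d n) that absorbs the linear term; [K] collects [Q]
     and the shift from n to n + 2. *)
  pose d := 1 - alpha0 R - beta; have d0 : 0 < d by rewrite /d; lra.
  have ln2 := ln2_gt0 R; pose c := d * ln 2; have c0 : 0 < c by rewrite mulr_gt0.
  pose K : R := Q%:R * 2 `^ (2 * beta); have K0 : 0 <= K by rewrite mulr_ge0 ?powR_ge0.
  near=> n.
  have n5 : (5 <= n)%N by near: n; exact: nbhs_infty_ge.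
  have n1 : 1 <= n%:R :> R by rewrite ler1n; lia.
  have nK : 4 * K / c ^+ 2 <= n%:R by near: n; exact: nbhs_infty_ger.
  apply: le_trans (QP n n5) _; rewrite lee_fin ler_expR.
  have two x y : 2 `^ (x + y) = 2 `^ x * 2 `^ y :> R.
    by apply: powRD; rewrite pnatr_eq0 implybT.
  have -> : - (beta * (n + 2)%:R) = (alpha0 R - 1) * n%:R + (d * n%:R - 2 * beta).
    by rewrite natrD /d; lra.
  rewrite two [leRHS]mulrC ler_wpM2r ?powR_ge0 // two powRN ler_pdivlMr ?powR_gt0 //.
  have -> : Q%:R * n.+1%:R * 2 `^ (2 * beta) = K * n.+1%:R :> R by rewrite mulrAC.
  apply: (@le_trans _ _ ((c * n%:R) ^+ 2 / 2)); last first.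
    have -> : 2 `^ (d * n%:R) = expR (c * n%:R) :> R.
      by rewrite /powR pnatr_eq0 /= /c mulrAC.
    by apply: quadratic_le_expR; rewrite mulr_ge0 // ltW.
  rewrite -(natr1 n); apply: linear_le_quadratic => //.
  by move: nK; rewrite ler_pdivrMr ?exprn_gt0.
split=> //.
have a1 := alpha0_lt1 R; pose beta := (1 - alpha0 R) / 2.
have b0 : 0 < beta by rewrite /beta; lra.
have b1 : 0 < beta < 1 - alpha0 R by rewrite b0 /beta /=; lra.
apply: (@squeeze_cvge _ _ _ _ (fun=> 1%:E) _
  (fun n : nat => (expR (2 `^ (- (beta * (n + 2)%:R))))%:E)).
- near=> n; apply/andP; split; first exact: inf_growth_rate_ge1.
  by near: n; exact: bound.
- exact: cvg_cst.
apply/fine_cvgP; split; first exact: nearW.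
rewrite -[X in _ --> X](expR0 R); apply: continuous_cvg; first exact: continuous_expR.
have small : `|2 `^ (- beta)| < 1 :> R.
  rewrite ger0_norm ?powR_ge0 // powRN invf_lt1 ?powR_gt0 //.
  by rewrite /powR pnatr_eq0 /= expR_gt1 mulr_gt0 // ln2_gt0.
(* The exponent of the upper bound is a geometric sequence of ratio 2^(-beta), shifted by 2. *)
have := cvg_expr small; rewrite -(cvg_shiftn 2) => lim0.
apply: cvg_trans lim0; apply: near_eq_cvg; apply: nearW => n.
by rewrite /= -[in RHS]mulNr [in RHS]powRrM powR_mulrn ?powR_ge0.
Unshelve. all: by end_near. Qed.
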